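(* Fix $W>0$. For $N\ge1$, consider channel configurations $\mathcal{W}=\bigcup_{n=1}^N\mathcal{W}_n$ with $\mathcal{W}_n=\{\omega:|\omega-\overline{\omega}_n|\le W/2\}$ pairwise disjoint (all of equal width $W$) satisfying $$(\mathcal{W}_{n_1}+\mathcal{W}_{n_2})\cap(\mathcal{W}_n+\mathcal{W}_{n_3})=\emptyset$$ for all $n_1,n_2,n,n_3\in\{1,\ldots,N\}$ with $(n_1,n_2)\ne(n,n_3)$ and $(n_1,n_2)\ne(n_3,n)$. Let $\eta(N)$ be the optimal (largest) spectral filling efficiency $$\frac{\sum_{n=1}^N W_n}{\max\mathcal{W}-\min\mathcal{W}}=\frac{NW}{\max\mathcal{W}-\min\mathcal{W}}$$ over all such configurations with $N$ channels. Then $\eta(N)\in\mathcal{O}(1/N)$ and $$\lim_{N\to\infty}\eta(N)\,N=\frac12.$$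
   Context: $\mathcal{A}+\mathcal{B}=\{a+b:a\in\mathcal{A},b\in\mathcal{B}\}$. The displayed disjointness condition is the condition under which the nonlinear Schrödinger fiber channel with ideal distributed brick-wall filters onto $\mathcal{W}$ conserves the energy in each channel separately (energy-decoupled system). *)

(* Defs.v *)
From HB Require Import structures.
From mathcomp Require Import all_boot all_order all_algebra.
From mathcomp Require Import all_classical all_reals all_analysis.
Set Implicit Arguments. Unset Strict Implicit. Unset Printing Implicit Defensive.
Import Order.TTheory GRing.Theory Num.Theory.
Local Open Scope classical_set_scope.
Local Open Scope ring_scope.

Definition msum {R : realType} (A B : set R) : set R :=
  [set x | exists a, exists b, [/\ A a, B b & x = a + b]].

Definition chan {R : realType} (W : R) {N : nat} (c : 'I_N -> R) (n : 'I_N)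
  : set R := [set w | `|w - c n| <= W / 2].

Definition band {R : realType} (W : R) {N : nat} (c : 'I_N -> R) : set R :=
  \bigcup_(n in [set: 'I_N]) chan W c n.

Definition admissible {R : realType} (W : R) {N : nat} (c : 'I_N -> R) : Prop :=
  (forall n m : 'I_N, n <> m -> chan W c n `&` chan W c m = set0) /\
  (forall n1 n2 n n3 : 'I_N, (n1, n2) <> (n, n3) -> (n1, n2) <> (n3, n) ->
     msum (chan W c n1) (chan W c n2) `&` msum (chan W c n) (chan W c n3) = set0).

Definition efficiency {R : realType} (W : R) {N : nat} (c : 'I_N -> R) : R :=
  (\sum_(n < N) W) / (sup (band W c) - inf (band W c)).

Definition eta_opt {R : realType} (W : R) (N : nat) : R :=
  sup [set e | exists c : 'I_N -> R, admissible W c /\ e = efficiency W c].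

(* Main.v *)
Require Import Defs.
From HB Require Import structures.
From mathcomp Require Import all_boot all_order all_algebra.
From mathcomp Require Import all_classical all_reals all_analysis.
From mathcomp Require Import perm cyclic finfield.
From mathcomp Require Import zify ring lra.
Set Implicit Arguments. Unset Strict Implicit. Unset Printing Implicit Defensive.
Import Order.TTheory GRing.Theory Num.Theory.
Import numFieldNormedType.Exports.
Local Open Scope classical_set_scope.
Local Open Scope ring_scope.

(** Two sums of channels are disjoint iff the corresponding sums of centres differ
    by more than 2W. Hence, in units of 2W, the centres form a real Sidon set with
    separation 1, and the claim says that N such points need a span of N^2 (1 + o(1)).

    The span is bounded below by Lindstrom's argument: among the sorted centres, the
    differences of lag at most m are separated, hence have a large sum, while those
    of lag r add up to at most r times the span.

    Bose's theorem gives q integers below q^2 that form a Sidon set, for every prime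
    power q. To use it for every N one needs a prime power in (N, (1 + eps) N] for
    large N, which follows from the prime number theorem psi(N) = N + o(N). The latter
    is proved following Selberg: the symmetry formula is obtained by Moebius inversion
    (Tatuzawa-Iseki) and iterated into
    |R(N)| ln^2 N <= 2 sum_(k <= N) ln k |R(N/k)| + O(N ln N) for R(N) = psi(N) - N.
    As R is small on a positive logarithmic proportion of the N/k, this inequality
    improves every bound |R(N)| <= alpha N by a definite amount. *)

(** * Dirichlet sums, the Moebius and von Mangoldt functions *)

(** The limit 1/2 is the reciprocal of the 2 in the unit [2 * W]: a span near [2 * W * N ^ 2]
    carries total width [N * W]. For the upper bound the maximal lag [m] is fixed, of order
    [1 / eps], before [N] grows; this loses only a factor [m / (m + 1)]. For the lower bound,
    Bertrand's postulate would not do: a prime up to [2 * N] costs a factor up to 4 in the span, so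
    prime gaps of size [o(N)] are required. Since [psi] jumps exactly at prime powers and Bose's
    construction accepts all of them, [psi] is never converted into a count of primes.

    Everything analytic lives on natural numbers: integrals become sums over [k] of values at
    [N %/ k], and rounding errors are absorbed in the error terms. In the final iteration the gain
    must depend only on a lower bound for [alpha], not on the threshold from which [alpha] is valid;
    otherwise the infimum of the valid [alpha] could be positive. *)

Lemma sum_divisors_hyperbola (V : zmodType) (h : nat -> nat -> V) N :
  \sum_(1 <= n < N.+1) \sum_(1 <= d < n.+1 | (d %| n)%N) h d (n %/ d)%N =
  \sum_(1 <= d < N.+1) \sum_(1 <= m < (N %/ d).+1) h d m.
Proof.
elim: N => [|N IH]; first by rewrite !big_geq.
rewrite big_nat_recr //= IH.
(* Passing from [N] to [N.+1] lengthens the inner range at [d] by one term exactly when [d] divides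
   [N.+1]. *)
have -> : \sum_(1 <= d < N.+2) \sum_(1 <= m < (N.+1 %/ d).+1) h d m =
  \sum_(1 <= d < N.+2) (\sum_(1 <= m < (N %/ d).+1) h d m +
     (if (d %| N.+1)%N then h d (N.+1 %/ d)%N else 0)).
  apply: eq_big_nat => d /andP[d0 _]; rewrite divnS //.
  case: (d %| N.+1)%N; last by rewrite addr0.
  by rewrite add1n big_nat_recr.
rewrite big_split /= -big_mkcond /=; congr (_ + _).
by rewrite [RHS]big_nat_recr //= divn_small // [X in _ = _ + X]big_geq // addr0.
Qed.

Lemma hyperbola_exchange (V : zmodType) (h : nat -> nat -> V) N :
  \sum_(1 <= d < N.+1) \sum_(1 <= m < (N %/ d).+1) h d m =
  \sum_(1 <= m < N.+1) \sum_(1 <= d < (N %/ m).+1) h d m.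
Proof.
have widen (g : nat -> nat -> V) :
    \sum_(1 <= d < N.+1) \sum_(1 <= m < (N %/ d).+1) g d m =
    \sum_(1 <= d < N.+1) \sum_(1 <= m < N.+1)
       (if (d * m <= N)%N then g d m else 0).
  apply: eq_big_nat => d /andP[d0 _].
  rewrite (@big_nat_widen _ _ _ 1 _ N.+1) ?ltnS ?leq_div // big_mkcond /=.
  by apply: eq_bigr => m _; rewrite ltnS leq_divRL // mulnC.
rewrite widen (widen (fun m d => h d m)) exchange_big /=.
by apply: eq_bigr => m _; apply: eq_bigr => d _; rewrite mulnC.
Qed.

Definition moebius {R : comNzRingType} (n : nat) : R :=
  \prod_(p <- primes n) (if logn p n == 1%N then -1 else 0).

Lemma moebius1 (R : comNzRingType) : moebius 1 = 1 :> R.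
Proof. by rewrite /moebius big_nil. Qed.

Lemma moebius_norm (R : realDomainType) n : `|moebius n : R| <= 1.
Proof.
rewrite /moebius; elim: (primes n) => [|p s IH]; first by rewrite big_nil normr1.
rewrite big_cons normrM mulr_ile1 //.
by case: ifP; rewrite ?normrN ?normr1 ?normr0.
Qed.

Lemma moebiusMprime (R : comNzRingType) p e : prime p -> (0 < e)%N ->
  moebius (p * e) = (if (p %| e)%N then 0 else - moebius e) :> R.
Proof.
move=> pp e0; have p0 := prime_gt0 pp; case: ifP => pe.
  have pin : p \in primes (p * e) by rewrite mem_primes pp muln_gt0 p0 e0 dvdn_mulr.
  rewrite /moebius (big_rem p pin) /= lognM // logn_prime // eqxx.
  have : (0 < logn p e)%N by rewrite logn_gt0 mem_primes pp e0.
  by case: (logn p e) => // k _; rewrite add1n mul0r.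
have perm_p : perm_eq (primes (p * e)) (p :: primes e).
  apply: uniq_perm; rewrite /= ?primes_uniq ?mem_primes ?pp ?e0 ?pe //.
  by move=> q; rewrite primesM // in_cons (primes_prime pp) mem_seq1.
rewrite /moebius (perm_big _ perm_p) big_cons lognM // logn_prime // eqxx.
have -> : logn p e = 0%N by apply/eqP; rewrite -leqn0 leqNgt logn_gt0 mem_primes pp e0 pe.
rewrite /= mulN1r; congr (- _); rewrite !big_seq; apply: eq_bigr => q.
rewrite mem_primes => /and3P[qp _ qe]; rewrite lognM // logn_prime //.
by case: (q =P p) => [eqp|]//; rewrite -eqp qe in pe.
Qed.

(** Write [n = p * m] with [p] the least prime factor. The divisors prime to [p] are divisors of
    [m]. The others are [p * e] with [e] dividing [m]; they count [- moebius e] if [p] does not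
    divide [e], and 0 otherwise. The two halves cancel. *)
Lemma sum_moebius_divisors (R : comNzRingType) n : (0 < n)%N ->
  \sum_(1 <= d < n.+1 | (d %| n)%N) moebius d = (n == 1%N)%:R :> R.
Proof.
move=> n0; have [n1|n1|->] := ltngtP n 1%N; [lia| |]; last first.
  by rewrite big_mkcond /= big_nat1 /= moebius1.
set p := pdiv n; have pp : prime p by apply: pdiv_prime.
have p0 := prime_gt0 pp.
have dn : n = (p * (n %/ p))%N by rewrite mulnC divnK // pdiv_dvd.
set m := (n %/ p)%N in dn; have m0 : (0 < m)%N by move: n0; rewrite dn muln_gt0 => /andP[].
rewrite (bigID (fun d => p %| d)%N) /=.
have -> : \sum_(1 <= d < n.+1 | (d %| n)%N && ~~ (p %| d)%N) moebius d =
   \sum_(1 <= d < m.+1 | (d %| m)%N && ~~ (p %| d)%N) (moebius d : R).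
  have mn : (m.+1 <= n.+1)%N by rewrite ltnS dn leq_pmull.
  rewrite [RHS](big_nat_widen _ _ _ _ _ mn) /=.
  apply: eq_bigl => d; case: (boolP (p %| d)%N) => pd; rewrite ?andbF //= !andbT.
  rewrite dn Gauss_dvdr; last by rewrite coprime_sym prime_coprime.
  by case: (boolP (d %| m)%N) => //= dm; rewrite ltnS dvdn_leq.
have -> : \sum_(1 <= d < n.+1 | (d %| n)%N && (p %| d)%N) (moebius d : R) =
   \sum_(1 <= e < m.+1 | (e %| m)%N) moebius (p * e).
  rewrite -big_filter -[RHS]big_filter -(big_map (muln p) xpredT moebius).
  apply: perm_big; apply: uniq_perm.
  - by rewrite filter_uniq ?iota_uniq.
  - rewrite map_inj_uniq ?filter_uniq ?iota_uniq // => a b /eqP.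
    by rewrite eqn_pmul2l // => /eqP.
  move=> d; apply/idP/mapP.
    rewrite mem_filter mem_index_iota => /andP[/andP[dvn /dvdnP[e de]] /andP[d0 _]].
    have em : (e %| m)%N by rewrite -(dvdn_pmul2l p0) -dn mulnC -de.
    exists e; last by rewrite mulnC.
    rewrite mem_filter mem_index_iota em ltnS (dvdn_leq m0 em) andbT /=.
    by apply: dvdn_gt0 em.
  move=> [e]; rewrite mem_filter mem_index_iota => /andP[em /andP[e0 _]] ->.
  have pen : (p * e %| n)%N by rewrite dn dvdn_pmul2l.
  by rewrite mem_filter mem_index_iota pen dvdn_mulr //= muln_gt0 p0 e0 ltnS dvdn_leq.
rewrite (bigID (fun d => p %| d)%N) /= big1_seq ?add0r; last first.
  move=> e /andP[/andP[em pe] _]; rewrite moebiusMprime ?pe //.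
  by apply: dvdn_gt0 em.
rewrite -big_split /= big1_seq // => e /andP[/andP[em pe] _].
by rewrite moebiusMprime ?(negbTE pe) ?addNr // (dvdn_gt0 _ em).
Qed.

(** By unique factorisation at most one term of the double sum survives. In this form, a sum over
    the divisors of a number can be exchanged into a count of the exponents allowed for each
    prime. *)
Definition mangoldt {R : realType} (n : nat) : R :=
  \sum_(1 <= p < n.+1 | prime p) \sum_(1 <= k < n.+1 | (p ^ k == n)%N) ln p%:R.

Lemma ln_nat_ge0 (R : realType) n : 0 <= ln n%:R :> R.
Proof. by case: n => [|n]; [rewrite ln0 | rewrite ln_ge0 // ler1n]. Qed.

Lemma mangoldt_ge0 (R : realType) n : 0 <= mangoldt n :> R.
Proof. by do 2 apply: sumr_ge0 => ? _; exact: ln_nat_ge0. Qed.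

Lemma mangoldt_neq0 (R : realType) n : mangoldt n != 0 :> R ->
  exists p k, [/\ prime p, (0 < k)%N & n = (p ^ k)%N].
Proof.
move=> n0; apply: contrapT => H; case/eqP: n0; rewrite /mangoldt.
rewrite big1 // => p pp; rewrite big1_seq // => k /andP[/eqP pk].
rewrite mem_index_iota => /andP[k0 _]; case: H; exists p, k; split=> //.
Qed.

Lemma sum_mangoldt_divisors (R : realType) n : (0 < n)%N ->
  \sum_(1 <= d < n.+1 | (d %| n)%N) mangoldt d = ln n%:R :> R.
Proof.
move=> n0.
(* The ranges depend on [d]; they are enlarged to the common bound [n] so that the sums can be
   exchanged. This adds no term, since [p ^ k = d] with [k > 0] forces [p] and [k] to be at most
   [d]. *)
have widen d : (1 <= d < n.+1)%N -> mangoldt d =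
    \sum_(1 <= p < n.+1 | prime p) \sum_(1 <= k < n.+1)
       (if (p ^ k == d)%N then ln p%:R else 0) :> R.
  move=> /andP[d0 dn]; rewrite /mangoldt.
  rewrite (big_nat_widen _ _ _ _ _ dn) big_mkcond /= [RHS]big_mkcond /=.
  apply: eq_bigr => p _; case: (boolP (prime p)) => //= pp.
  have kd k : (p ^ k == d)%N -> (k < d.+1)%N.
    by move=> /eqP <-; rewrite ltnS ltnW // ltn_expl // prime_gt1.
  rewrite (big_nat_widen _ _ _ _ _ dn) big_mkcond /=.
  rewrite -[RHS]big_mkcond /=.
  case: (ltnP p d.+1) => pd; last first.
    rewrite big1_seq // => k /andP[/eqP pk]; rewrite mem_index_iota => /andP[k0 _].
    by move: pd; rewrite -pk ltnNge -{1}(expn1 p) leq_pexp2l // prime_gt0.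
  rewrite [RHS]big_mkcond; apply: eq_bigr => k _.
  by case: (boolP (p ^ k == d)%N) => //= pk; rewrite kd.
rewrite big_nat_cond (eq_bigr _ (fun d H => widen d (proj1 (andP H)))) -big_nat_cond.
rewrite exchange_big /=.
transitivity (\sum_(1 <= p < n.+1 | prime p) (logn p n)%:R * ln p%:R : R).
  apply: eq_bigr => p pp; rewrite exchange_big /=.
  have -> : \sum_(1 <= k < n.+1) \sum_(1 <= d < n.+1 | (d %| n)%N)
     (if (p ^ k == d)%N then ln p%:R else 0 : R) =
     \sum_(1 <= k < n.+1) (if (k < (logn p n).+1)%N then ln p%:R else 0).
    apply: eq_big_nat => k /andP[k0 kn].
    rewrite ltnS -pfactor_dvdn // -big_mkcondr /=.
    case: ifP => pk; last first.
      by rewrite big1 // => d /andP[dn /eqP e]; rewrite e dn in pk.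
    rewrite (big_rem (p ^ k)%N) /=; last first.
      by rewrite mem_index_iota ltnS expn_gt0 prime_gt0 // dvdn_leq.
    rewrite pk eqxx /= big1_seq ?addr0 // => d /andP[/andP[_ /eqP <-]].
    by rewrite mem_rem_uniq ?iota_uniq // inE eqxx.
  rewrite -big_mkcond -(big_nat_widen _ _ _ xpredT) /=.
    by rewrite sumr_const_nat subn1 /= mulr_natl.
  by rewrite ltnS ltnW // ltn_logl.
have e : n = (\prod_(1 <= p < n.+1 | prime p) p ^ logn p n)%N.
  rewrite -{1}(partnT n0) /partn big_nat_recl //= lognE /= expn0 mul1n big_mkcond.
  rewrite [RHS]big_mkcond /= big_add1 /=.
  apply: eq_bigr => p _; case: ifP => // np.
  by rewrite lognE np.
rewrite [in RHS]e natr_prod.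
elim: (index_iota 1 n.+1) => [|p s IH]; first by rewrite !big_nil ln1.
rewrite !big_cons; case: ifP => // pp.
rewrite lnM ?IH ?natrX ?lnXn ?mulr_natl ?posrE ?exprn_gt0 ?ltr0n ?prime_gt0 //.
by apply: prodr_gt0 => q qp; rewrite ltr0n expn_gt0 prime_gt0.
Qed.

Lemma mangoldt_le_ln (R : realType) n : mangoldt n <= ln n%:R :> R.
Proof.
case: n => [|n]; first by rewrite /mangoldt big_geq // ln_nat_ge0.
rewrite -sum_mangoldt_divisors // big_mkcond big_nat_recr //= dvdnn lerDr.
by apply: sumr_ge0 => d _; case: ifP => // _; exact: mangoldt_ge0.
Qed.

(** * Estimates of Chebyshev and Mertens *)

Lemma ln_sub_le (R : realType) (x y : R) : 0 < x -> 0 < y ->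
  ln x - ln y <= x / y - 1.
Proof.
move=> x0 y0; rewrite -ln_div ?posrE //.
have := @le_ln1Dx R (x / y - 1).
have -> : 1 + (x / y - 1) = x / y by ring.
by apply; have := divr_gt0 x0 y0; lra.
Qed.

(** Together with [ln_succ_ge], this replaces the comparison of [1 / x] with its integral over a
    unit interval. *)
Lemma ln_succ_le (R : realType) n : (0 < n)%N ->
  n%:R * (ln n.+1%:R - ln n%:R) <= 1 :> R.
Proof.
move=> n0; have n0' : 0 < n%:R :> R by rewrite ltr0n.
have := @ln_sub_le R n.+1%:R n%:R; rewrite ltr0n => /(_ isT n0') h.
rewrite mulrC -ler_pdivlMr //; apply: le_trans h _.
by rewrite -natr1 mulrDl divff ?gt_eqF // addrAC subrr add0r.
Qed.

Lemma ln_succ_ge (R : realType) n : (0 < n)%N ->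
  1 <= n.+1%:R * (ln n.+1%:R - ln n%:R) :> R.
Proof.
move=> n0; have n0' : 0 < n%:R :> R by rewrite ltr0n.
have n1 : 0 < n.+1%:R :> R by rewrite ltr0n.
have h := @ln_sub_le R n%:R n.+1%:R n0' n1.
rewrite mulrC -ler_pdivrMr // div1r -opprB lerNr; apply: le_trans h _.
by rewrite -subr_ge0 -natr1 in n1 *; rewrite le_eqVlt; apply/orP; left; apply/eqP; field; lra.
Qed.

Lemma ler_ln_nat (R : realType) m n : (0 < m)%N -> (m <= n)%N ->
  ln m%:R <= ln n%:R :> R.
Proof.
by move=> m0 mn; rewrite ler_ln ?posrE ?ltr0n ?ler_nat // (leq_trans m0).
Qed.

Lemma ln_nat_le (R : realType) n : ln n%:R <= n%:R :> R.
Proof.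
by case: n => [|n]; [rewrite ln0 | apply: ltW; rewrite ln_sublinear ?ltr0n].
Qed.

Lemma divn_le (R : realType) N d : (N %/ d)%:R <= N%:R / d%:R :> R.
Proof.
case: d => [|d]; first by rewrite divn0 invr0 mulr0.
by rewrite ler_pdivlMr ?ltr0n // -natrM ler_nat leq_trunc_div.
Qed.

Lemma divn_gt (R : realType) N d : (0 < d)%N ->
  N%:R / d%:R < (N %/ d)%:R + 1 :> R.
Proof.
by move=> d0; rewrite ltr_pdivrMr ?ltr0n // natr1 -natrM ltr_nat ltn_ceil.
Qed.

Definition log_fact {R : realType} N : R := \sum_(1 <= k < N.+1) ln k%:R.

Lemma log_factE (R : realType) N : (0 < N)%N ->
  N%:R * ln N%:R - N%:R <= (log_fact N : R) <= N%:R * ln N%:R - N%:R + ln N%:R + 1.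
Proof.
elim: N => // -[_ _|N /(_ isT) IH _].
  by rewrite /log_fact big_nat1 ln1; apply/andP; split; lra.
rewrite /log_fact big_nat_recr //=; move: IH; rewrite -/(log_fact N.+1).
have := @ln_succ_le R N.+1 isT; have := @ln_succ_ge R N.+1 isT.
rewrite -[N.+2%:R]natr1; set n := N.+1%:R; set a := ln n; set b := ln (n + 1).
by move=> h1 h2 /andP[h3 h4]; apply/andP; split; lra.
Qed.

Definition harmonic_sum {R : realType} N : R := \sum_(1 <= k < N.+1) k%:R^-1.

Lemma harmonic_sum_le (R : realType) N : (0 < N)%N ->
  harmonic_sum N <= ln N%:R + 1 :> R.
Proof.
elim: N => // -[_ _|N /(_ isT) IH _].
  by rewrite /harmonic_sum big_nat1 ln1 invr1 add0r.
rewrite /harmonic_sum big_nat_recr //= -/(harmonic_sum N.+1).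
have := @ln_succ_ge R N.+1 isT.
by rewrite mulrC -ler_pdivrMr ?ltr0n // div1r; set i := _^-1; lra.
Qed.

(** The sequence [u] decreases, [v] increases, and no value of [v] exceeds a value of [u], so the
    supremum of [v] is within the reciprocal of both. An error this small is needed because it is
    later multiplied by a real number within 1 of [N]. *)
Lemma euler_gamma_exists (R : realType) : exists g : R,
  forall N, (0 < N)%N -> `|harmonic_sum N - ln N%:R - g| <= N%:R^-1.
Proof.
pose u N : R := harmonic_sum N.+1 - ln N.+1%:R.
pose v N : R := u N - N.+1%:R^-1.
have step N : harmonic_sum N.+2 = harmonic_sum N.+1 + N.+2%:R^-1 :> R.
  by rewrite /harmonic_sum big_nat_recr.
have vN : {homo v : n m / (n <= m)%N >-> n <= m}.
  apply/nondecreasing_seqP => N; rewrite /v /u step.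
  have := @ln_succ_le R N.+1 isT.
  by rewrite mulrC -ler_pdivlMr ?ltr0n // div1r; set i := N.+1%:R^-1; set j := N.+2%:R^-1; lra.
have uN : {homo u : n m / (n <= m)%N >-> m <= n}.
  apply/nonincreasing_seqP => N; rewrite /u step.
  have := @ln_succ_ge R N.+1 isT.
  by rewrite mulrC -ler_pdivrMr ?ltr0n // div1r; set i := N.+2%:R^-1; lra.
have vu m n : v m <= u n.
  apply: (le_trans (vN _ _ (leq_maxl m n))).
  apply: le_trans (uN _ _ (leq_maxr m n)).
  by rewrite /v lerBlDr lerDl invr_ge0.
exists (sup (range v)) => -[//|N] _.
have h1 : v N <= sup (range v).
  apply: ub_le_sup; last by exists N.
  by exists (u 0%N) => _ [m _ <-].
have h2 : sup (range v) <= u N.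
  apply: ge_sup; first by exists (v 0%N), 0%N.
  by move=> _ [m _ <-].
rewrite -/(u N); move: h1 h2; rewrite /v => h1 h2.
have : 0 <= N.+1%:R^-1 :> R by rewrite invr_ge0.
rewrite ler_norml; move: h1 h2; set i := N.+1%:R^-1 => h1 h2 i0.
by apply/andP; split; lra.
Qed.

Lemma sum_inv_sqrt_le (R : realType) N :
  \sum_(1 <= k < N.+1) (Num.sqrt k%:R)^-1 <= 2 * Num.sqrt N%:R :> R.
Proof.
elim: N => [|N IH]; first by rewrite big_geq // sqrtr0 mulr0.
rewrite big_nat_recr //=; apply: le_trans (lerD IH (lexx _)) _.
set a := Num.sqrt N%:R; set b := Num.sqrt N.+1%:R.
have a0 : 0 <= a by rewrite sqrtr_ge0.
have b0 : 0 < b by rewrite sqrtr_gt0 ltr0n.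
have ab : b ^+ 2 = a ^+ 2 + 1 by rewrite !sqr_sqrtr ?ler0n // natr1.
rewrite -(ler_pM2r b0) mulrDl mulVf ?gt_eqF //.
have := sqr_ge0 (b - a); rewrite !expr2 in ab *; nra.
Qed.

(** With [t] the fourth root of [N], [ln N = 4 * ln t <= 4 * (t - 1)]. Trading squared logarithms of
    [N %/ d] for square roots of [N / d] gives a sum over [d] of size [O(N)]. *)
Lemma sqr_ln_le_sqrt (R : realType) N : (0 < N)%N ->
  (1 + ln N%:R) ^+ 2 <= 16 * Num.sqrt N%:R :> R.
Proof.
move=> N0; set s := Num.sqrt N%:R.
set t := Num.sqrt s.
have n0 : 0 < N%:R :> R by rewrite ltr0n.
have s0 : 0 < s by rewrite sqrtr_gt0.
have t0 : 0 < t by rewrite sqrtr_gt0.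
have ts : t ^+ 2 = s by rewrite sqr_sqrtr // ltW.
have lnt : ln N%:R = 4 * ln t.
  have -> : N%:R = t ^+ 4 by rewrite (exprM t 2 2) ts sqr_sqrtr // ltW.
  by rewrite lnXn // mulr_natl.
have h : ln t <= t - 1 by have := @ln_sub_le R t 1 t0 ltr01; rewrite ln1 divr1; lra.
have h0 : 0 <= ln N%:R :> R by exact: ln_nat_ge0.
rewrite lnt in h0 *; rewrite -ts; nra.
Qed.

Definition chebyshev_psi {R : realType} N : R := \sum_(1 <= k < N.+1) mangoldt k.
Local Notation psi := chebyshev_psi.

Lemma psi0 (R : realType) : psi 0 = 0 :> R.
Proof. by rewrite /psi big_geq. Qed.

Lemma psiS (R : realType) N : psi N.+1 = psi N + mangoldt N.+1 :> R.
Proof. by rewrite /psi big_nat_recr. Qed.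

Lemma ler_psi (R : realType) m n : (m <= n)%N -> psi m <= psi n :> R.
Proof.
move: m n; apply: (@homo_leq _ (@psi R) (fun x y => x <= y)) => //.
  by move=> x y z; apply: le_trans.
by move=> n; rewrite psiS lerDl mangoldt_ge0.
Qed.

Lemma psi_ge0 (R : realType) n : 0 <= psi n :> R.
Proof. by rewrite -psi0 ler_psi. Qed.

Lemma sum_mangoldt_floor (R : realType) N :
  \sum_(1 <= d < N.+1) mangoldt d * (N %/ d)%:R = log_fact N :> R.
Proof.
have := @sum_divisors_hyperbola R (fun d _ => mangoldt d) N.
rewrite /log_fact (eq_big_nat _ _ (F2 := fun k => ln k%:R)); last first.
  by move=> k /andP[k0 _]; rewrite sum_mangoldt_divisors.
move=> ->; apply: eq_bigr => d _.
by rewrite sumr_const_nat subn1 /= mulr_natr.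
Qed.

Lemma sum_psi_floor (R : realType) N :
  \sum_(1 <= m < N.+1) psi (N %/ m) = log_fact N :> R.
Proof.
rewrite -sum_mangoldt_floor /psi (hyperbola_exchange (fun m d => mangoldt d)).
by apply: eq_bigr => d _; rewrite sumr_const_nat subn1 /= mulr_natr.
Qed.

(** Chebyshev's argument: with [M = N %/ 2], the coefficient [N %/ d - 2 * (M %/ d)] is never
    negative and is at least 1 for [M < d <= N], while Stirling's bounds control
    [log_fact N - 2 * log_fact M]. *)
Lemma psi_half_le (R : realType) N : (1 < N)%N ->
  psi N - psi (N %/ 2) <= 5 * N%:R :> R.
Proof.
move=> N1; set M := (N %/ 2)%N; have M0 : (0 < M)%N by rewrite divn_gt0.
have MN : (M <= N)%N by rewrite leq_div.
apply: (@le_trans _ _ (log_fact N - 2 * log_fact M)).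
  have -> : log_fact M = \sum_(1 <= d < N.+1) mangoldt d * (M %/ d)%:R :> R.
    rewrite -sum_mangoldt_floor [RHS](@big_cat_nat _ _ _ M.+1) //=.
    rewrite [X in _ = _ + X]big1_seq ?addr0 // => d; rewrite mem_index_iota => /andP[_ /andP[Md _]].
    by rewrite divn_small // mulr0.
  rewrite -sum_mangoldt_floor mulr_sumr -sumrB /psi.
  rewrite (@big_cat_nat _ _ _ M.+1) //= addrAC subrr add0r.
  rewrite [leRHS](@big_cat_nat _ _ _ M.+1) //= -[leLHS]add0r; apply: lerD.
    rewrite big_nat; apply: sumr_ge0 => d /andP[d0 _].
    rewrite (mulrC 2) -mulrA -mulrBr mulr_ge0 ?mangoldt_ge0 // subr_ge0 -natrM ler_nat.
    by rewrite /M -divnMA (mulnC 2) divnMA leq_trunc_div.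
  rewrite !big_nat; apply: ler_sum => d /andP[Md dN].
  rewrite (divn_small Md) mulr0n mulr0 mulr0 subr0 ler_peMr ?mangoldt_ge0 //.
  by rewrite ler1n divn_gt0 // (leq_ltn_trans _ Md).
have /andP[_ h1] := @log_factE R N (ltnW N1).
have /andP[h2 _] := @log_factE R M M0.
have n0 : 0 < N%:R :> R by rewrite ltr0n ltnW.
have m0 : 1 <= M%:R :> R by rewrite ler1n.
have l0 := @ln_nat_le R N; have l1 := @ln_nat_ge0 R N.
have n1 : 2 * M%:R <= N%:R :> R by rewrite -natrM ler_nat; rewrite /M; lia.
have n2 : N%:R <= 2 * M%:R + 1 :> R by rewrite -natrM natr1 ler_nat /M; lia.
have m1 : 0 < M%:R :> R by lra.
have := @ln_sub_le R N%:R M%:R n0 m1.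
have h3 : N%:R / M%:R <= 3 :> R by rewrite ler_pdivrMr //; lra.
move: h1 h2 l0 l1 n1 n2 h3.
set a := ln N%:R; set b := ln M%:R; set n := N%:R; set m := M%:R => h1 h2 l0 l1 n1 n2 h3 h4.
have h5 : 2 * m * (a - b) <= 2 * m * 2 by rewrite ler_pM2l; lra.
have h6 : (n - 2 * m) * a <= a by rewrite ler_piMl //; lra.
have h7 : 2 <= n by rewrite /n ler_nat.
lra.
Qed.

Lemma psi_le (R : realType) N : psi N <= 10 * N%:R :> R.
Proof.
elim/ltn_ind: N => -[|[|N]] IH; first by rewrite psi0 mulr0.
  rewrite /psi big_nat1; apply: le_trans (mangoldt_le_ln _ _) _.
  by rewrite ln1; lra.
have := @psi_half_le R N.+2 isT; have := IH (N.+2 %/ 2)%N.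
have -> : (N.+2 %/ 2 < N.+2)%N by rewrite ltn_Pdiv.
move=> /(_ isT); have := divn_le R N.+2 2; lra.
Qed.

(** In [sum_mangoldt_floor], replacing each [N %/ d] by [N / d] costs at most [psi N <= 10 * N];
    Stirling's bounds and a division by [N] do the rest. *)
Lemma mertens (R : realType) N : (0 < N)%N ->
  `|\sum_(1 <= d < N.+1) mangoldt d / d%:R - ln N%:R| <= 12 :> R.
Proof.
move=> N0; set S := \sum_(_ <= _ < _) _.
have n0 : 0 < N%:R :> R by rewrite ltr0n.
have e : N%:R * S - log_fact N = \sum_(1 <= d < N.+1) mangoldt d * (N%:R / d%:R - (N %/ d)%:R) :> R.
  rewrite -sum_mangoldt_floor mulr_sumr -sumrB; apply: eq_bigr => d _.
  by rewrite mulrBr mulrCA.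
have h1 : 0 <= N%:R * S - log_fact N.
  by rewrite e sumr_ge0 // => d _; rewrite mulr_ge0 ?mangoldt_ge0 // subr_ge0 divn_le.
have h2 : N%:R * S - log_fact N <= psi N.
  rewrite e /psi !big_nat; apply: ler_sum => d /andP[d0 _].
  rewrite ler_piMr ?mangoldt_ge0 //; have := @divn_gt R N d d0; lra.
have /andP[h3 h4] := @log_factE R N N0; have h5 := @psi_le R N.
have h6 := @ln_nat_le R N; have h7 : 1 <= N%:R :> R by rewrite ler1n.
rewrite -(ler_pM2l n0) -{1}(gtr0_norm n0) -normrM mulrBr ler_norml.
by apply/andP; split; lra.
Qed.

Lemma sum_mangoldt_div_le (R : realType) N : (0 < N)%N ->
  \sum_(1 <= d < N.+1) mangoldt d / d%:R <= ln N%:R + 12 :> R.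
Proof. by move=> /(@mertens R); rewrite ler_norml => /andP[]; lra. Qed.

(** The partial sums of [a] are shown to equal [psi N] for every [N], and differences then identify
    [a] with [mangoldt]. Working with partial sums requires only the hyperbola exchange, not the
    associativity of Dirichlet convolution. Finally [ln d = ln n - ln (n %/ d)]. *)
Lemma sum_moebius_ln (R : realType) n : (0 < n)%N ->
  \sum_(1 <= d < n.+1 | (d %| n)%N) moebius d * ln d%:R = - mangoldt n :> R.
Proof.
pose a n : R := \sum_(1 <= d < n.+1 | (d %| n)%N) moebius d * ln (n %/ d)%:R.
have sa N : \sum_(1 <= n < N.+1) a n = psi N.
  rewrite (sum_divisors_hyperbola (fun d m => moebius d * ln m%:R)).
  transitivity (\sum_(1 <= d < N.+1) \sum_(1 <= e < (N %/ d).+1)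
                  (moebius d * (mangoldt e * (N %/ (d * e))%:R) : R)).
    apply: eq_bigr => d _; rewrite -!mulr_sumr; congr (_ * _).
    rewrite -/(log_fact _) -sum_mangoldt_floor.
    by apply: eq_bigr => e _; rewrite divnMA.
  rewrite hyperbola_exchange /psi; apply: eq_big_nat => e /andP[e0 eN].
  transitivity (mangoldt e * \sum_(1 <= d < (N %/ e).+1) (moebius d * (N %/ e %/ d)%:R) : R).
    rewrite mulr_sumr; apply: eq_bigr => d _.
    by rewrite mulrCA mulnC divnMA.
  have -> : \sum_(1 <= d < (N %/ e).+1) moebius d * (N %/ e %/ d)%:R =
     \sum_(1 <= n < (N %/ e).+1) \sum_(1 <= d < n.+1 | (d %| n)%N) moebius d :> R.
    rewrite (sum_divisors_hyperbola (fun d m => moebius d)).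
    by apply: eq_bigr => d _; rewrite sumr_const_nat subn1 /= mulr_natr.
  rewrite big_nat_recl ?divn_gt0 //= sum_moebius_divisors // eqxx.
  rewrite big_nat big1 ?addr0 ?mulr1 // => d /andP[d0 _].
  by rewrite sum_moebius_divisors //; case: d d0.
have an m : (0 < m)%N -> a m = mangoldt m.
  case: m => // m _; have := sa m.+1; rewrite big_nat_recr //= sa psiS.
  exact: addrI.
move=> n0; rewrite -an // /a -sumrN.
have -> : \sum_(1 <= d < n.+1 | (d %| n)%N) - (moebius d * ln (n %/ d)%:R : R) =
   \sum_(1 <= d < n.+1 | (d %| n)%N) (moebius d * ln d%:R - moebius d * ln n%:R).
  rewrite big_nat_cond [RHS]big_nat_cond; apply: eq_bigr => d /andP[/andP[d0 _] dn].
  have -> : ln n%:R = ln (n %/ d)%:R + ln d%:R :> R.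
    by rewrite -lnM -?natrM ?divnK // posrE ltr0n // divn_gt0 // dvdn_leq.
  by rewrite mulrDr opprD addrCA subrr addr0.
rewrite sumrB -mulr_suml sum_moebius_divisors //.
by case: eqP => [->|]; rewrite ?ln1 ?mulr0 ?mul0r subr0.
Qed.

(** * Selberg's symmetry formula *)

Lemma ln_divn_bounds (R : realType) N d : (0 < d <= N)%N ->
  ln (N %/ d)%:R <= (ln N%:R - ln d%:R : R) <= 1 + ln (N %/ d)%:R.
Proof.
move=> /andP[d0 dN]; have N0 := leq_trans d0 dN.
have m0 : 1 <= (N %/ d)%:R :> R by rewrite ler1n divn_gt0.
have m1 : ((N %/ d)%:R + 1) / (N %/ d)%:R <= 2 :> R by rewrite ler_pdivrMr; lra.
have q0 : 0 < N%:R / d%:R :> R by rewrite divr_gt0 ?ltr0n.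
rewrite -ln_div ?posrE ?ltr0n //; apply/andP; split.
  by rewrite ler_ln ?posrE ?divn_le //; lra.
have h : ln (N%:R / d%:R) <= ln ((N %/ d)%:R + 1) :> R.
  by rewrite ler_ln ?posrE //; apply/ltW/divn_gt.
have h1 : ln ((N %/ d)%:R + 1) - ln (N %/ d)%:R <=
    ((N %/ d)%:R + 1) / (N %/ d)%:R - 1 :> R by apply: ln_sub_le; lra.
by move: m1 h1 h; set q := _ / _; lra.
Qed.

(** Moebius inversion with a logarithmic weight: collecting the terms with [d * m = n], the
    coefficient of [F n] is the divisor sum of [moebius d * (ln N - ln d)], which is [ln N] at
    [n = 1] plus [mangoldt n]. *)
Lemma tatuzawa_iseki (R : realType) N (F : nat -> R) : (0 < N)%N ->
  \sum_(1 <= d < N.+1) moebius d * (ln N%:R - ln d%:R) *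
     \sum_(1 <= m < (N %/ d).+1) F (d * m)%N =
  F 1%N * ln N%:R + \sum_(1 <= n < N.+1) mangoldt n * F n.
Proof.
move=> N0.
transitivity (\sum_(1 <= n < N.+1) F n * ((n == 1%N)%:R * ln N%:R + mangoldt n)).
  have := sum_divisors_hyperbola
    (fun d m => moebius d * (ln N%:R - ln d%:R) * F (d * m)%N : R) N.
  move=> e; rewrite -[LHS]/(\sum_(1 <= d < N.+1) _).
  transitivity (\sum_(1 <= d < N.+1) \sum_(1 <= m < (N %/ d).+1)
      (moebius d * (ln N%:R - ln d%:R) * F (d * m)%N)).
    by apply: eq_bigr => d _; rewrite mulr_sumr.
  rewrite -e; apply: eq_big_nat => n /andP[n0 _].
  rewrite -sum_moebius_divisors // -[mangoldt n]opprK -sum_moebius_ln //.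
  rewrite mulr_suml -sumrB mulr_sumr; apply: eq_bigr => d dn.
  by rewrite (mulnC d) divnK // -mulrBr mulrC.
rewrite big_nat_recl // eqxx mul1r mulrDr -addrA; congr (_ + _).
rewrite [in RHS]big_nat_recl // mulrC; congr (_ + _).
rewrite !big_nat; apply: eq_bigr => n /andP[n0 _].
by case: n n0 => // n _; rewrite mul0r add0r mulrC.
Qed.

(** With [M = N %/ d] and [y = N / d], [log_fact M] is about [M * ln M - M] and [y * harmonic_sum M]
    is about [y * (ln M + g)]. The multiple [g + 1] of [M] is exactly what cancels the linear terms
    and leaves a logarithm. *)
Lemma tatuzawa_inner_bound (R : realType) (g : R) N d :
  (forall N, (0 < N)%N -> `|harmonic_sum N - ln N%:R - g| <= N%:R^-1) ->
  (0 < d <= N)%N ->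
  `|log_fact (N %/ d) - N%:R / d%:R * harmonic_sum (N %/ d) + (g + 1) * (N %/ d)%:R|
    <= (3 + `|g|) * (1 + ln (N %/ d)%:R).
Proof.
move=> hg /andP[d0 dN].
have M0 : (0 < N %/ d)%N by rewrite divn_gt0.
have /andP[h1 h2] := @log_factE R _ M0.
have h3 := hg _ M0.
have h4 := divn_le R N d; have h5 := @divn_gt R N d d0.
have l0 := @ln_nat_ge0 R (N %/ d).
move: M0 h1 h2 h3 h4 h5 l0; set M := (N %/ d)%N; set y := N%:R / d%:R.
set H := harmonic_sum M; set a := ln M%:R; set m := M%:R => M0 h1 h2 h3 h4 h5 l0.
have m1 : 1 <= m by rewrite ler1n.
have e3 : `|y * (H - a - g)| <= 2.
  rewrite normrM (ger0_norm (_ : 0 <= y)); last by lra.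
  apply: (@le_trans _ _ (y * m^-1)); first by rewrite ler_wpM2l //; lra.
  by rewrite ler_pdivrMr; lra.
have e1 : `|(m - y) * (a + g)| <= a + `|g|.
  rewrite normrM; apply: (@le_trans _ _ (1 * `|a + g|)).
    by rewrite ler_wpM2r // ler_norml; apply/andP; split; lra.
  by rewrite mul1r (le_trans (ler_normD _ _)) // (ger0_norm l0).
have e2 : `|log_fact M - (m * a - m)| <= a + 1.
  by rewrite ler_norml; apply/andP; split; lra.
have -> : log_fact M - y * H + (g + 1) * m =
  (m - y) * (a + g) + (log_fact M - (m * a - m)) - y * (H - a - g) by ring.
apply: le_trans (ler_normB _ _) _.
apply: le_trans (lerD (ler_normD _ _) (lexx _)) _.
have g0 := normr_ge0 g.
have : 0 <= `|g| * a by rewrite mulr_ge0.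
lra.
Qed.

Lemma selberg_formula (R : realType) : exists C : R, 0 <= C /\
  forall N, (0 < N)%N ->
  `|psi N * ln N%:R + \sum_(1 <= n < N.+1) mangoldt n * psi (N %/ n)
     - 2 * (N%:R * ln N%:R)| <= C * N%:R.
Proof.
have [g hg] := @euler_gamma_exists R.
set K : R := 3 + `|g|; have K0 : 0 <= K by rewrite addr_ge0.
have A0 : 0 <= 32 * K + 11 * `|g + 1| + 12.
  by have := normr_ge0 (g + 1); lra.
exists (32 * K + 11 * `|g + 1| + 12); split => // N N0.
have n0 : 0 < N%:R :> R by rewrite ltr0n.
(* The constant [g + 1] is chosen so that the sums of [F] over the multiples of [d] are the
   expressions bounded by [tatuzawa_inner_bound]. *)
pose F n : R := psi (N %/ n) - N%:R / n%:R + (g + 1).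
have key : `|F 1%N * ln N%:R + \sum_(1 <= n < N.+1) mangoldt n * F n| <= 32 * K * N%:R.
  rewrite -tatuzawa_iseki //.
  apply: le_trans (ler_norm_sum _ _ _) _.
  apply: (@le_trans _ _ (\sum_(1 <= d < N.+1) 16 * K * Num.sqrt N%:R * (Num.sqrt d%:R)^-1)).
    rewrite !big_nat; apply: ler_sum => d /andP[d0 dN].
    have M0 : (0 < N %/ d)%N by rewrite divn_gt0.
    have -> : \sum_(1 <= m < (N %/ d).+1) F (d * m)%N =
        log_fact (N %/ d) - N%:R / d%:R * harmonic_sum (N %/ d) + (g + 1) * (N %/ d)%:R.
      rewrite -sum_psi_floor mulr_sumr -sumrB.
      have -> : (g + 1) * (N %/ d)%:R = \sum_(1 <= m < (N %/ d).+1) (g + 1).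
        by rewrite sumr_const_nat subn1 mulr_natr.
      rewrite -big_split /=.
      apply: eq_bigr => m _; rewrite /F divnMA natrM invfM mulrA //.
    have b1 := @tatuzawa_inner_bound R g N d hg; rewrite d0 /= in b1.
    have {b1} := b1 dN; rewrite -/K => b1.
    have l1 : 0 <= ln (N %/ d)%:R :> R by apply: ln_nat_ge0.
    have /andP[b2 b3] := @ln_divn_bounds R N d (introT andP (conj d0 dN)).
    rewrite !normrM.
    apply: (@le_trans _ _ (1 * (1 + ln (N %/ d)%:R) * (K * (1 + ln (N %/ d)%:R)))).
      apply: ler_pM => //; rewrite ?mulr_ge0 //.
      apply: ler_pM => //; rewrite ?moebius_norm //.
      by rewrite ger0_norm; lra.
    have -> : 1 * (1 + ln (N %/ d)%:R) * (K * (1 + ln (N %/ d)%:R)) = K * (1 + ln (N %/ d)%:R) ^+ 2 by ring.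
    rewrite (mulrC 16) -!mulrA ler_wpM2l //.
    apply: le_trans (sqr_ln_le_sqrt R M0) _.
    rewrite ler_wpM2l // -sqrtrV ?ler0n // -sqrtrM ?ler0n // ler_wsqrtr //.
    exact: divn_le.
  rewrite -mulr_sumr.
  have h : 0 <= 16 * K * Num.sqrt N%:R by rewrite !mulr_ge0 ?sqrtr_ge0.
  apply: le_trans (ler_wpM2l h (sum_inv_sqrt_le R N)) _.
  have := @sqr_sqrtr R N%:R (ltW n0); rewrite expr2 => e.
  have -> : 16 * K * Num.sqrt N%:R * (2 * Num.sqrt N%:R) = 32 * K * (Num.sqrt N%:R * Num.sqrt N%:R) by ring.
  by rewrite e.
set P := psi N * ln N%:R + _ - _.
set S : R := \sum_(1 <= d < N.+1) mangoldt d / d%:R.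
(* Of the two copies of [N * ln N], one comes from [F 1] and the other from the sum of
   [mangoldt d / d] by [mertens]. *)
have -> : P = (F 1%N * ln N%:R + \sum_(1 <= n < N.+1) mangoldt n * F n)
   - (g + 1) * (ln N%:R + psi N) + N%:R * (S - ln N%:R).
  have -> : \sum_(1 <= n < N.+1) mangoldt n * F n =
    \sum_(1 <= n < N.+1) mangoldt n * psi (N %/ n) - N%:R * S + (g + 1) * psi N.
    rewrite /S /psi !mulr_sumr -sumrB -big_split /=; apply: eq_bigr => n _.
    by rewrite /F /psi; ring.
  by rewrite /P /F divn1 divr1; ring.
apply: le_trans (ler_normD _ _) _.
apply: le_trans (lerD (ler_normB _ _) (lexx _)) _.
have t1 : `|(g + 1) * (ln N%:R + psi N)| <= 11 * `|g + 1| * N%:R.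
  have l1 := @ln_nat_ge0 R N; have l2 := @psi_ge0 R N.
  have l3 := @ln_nat_le R N; have l4 := @psi_le R N.
  rewrite normrM (mulrC 11) -mulrA ler_wpM2l // ger0_norm; lra.
have t2 : `|N%:R * (S - ln N%:R)| <= 12 * N%:R.
  by rewrite normrM (gtr0_norm n0) mulrC ler_wpM2r ?mertens // ltW.
move: key t1 t2; set u := `|_|; set v := `|_|; set w := `|_ * (S - _)|; lra.
Qed.

(** * Iterating Selberg's formula *)

Definition psi_error {R : realType} N : R := psi N - N%:R.

Lemma psi_error_le (R : realType) N : `|psi_error N : R| <= 10 * N%:R.
Proof.
have := @psi_ge0 R N; have := @psi_le R N; have : 0 <= N%:R :> R by [].
by rewrite /psi_error ler_norml => h1 h2 h3; apply/andP; split; lra.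
Qed.

Lemma psi_error_div_le (R : realType) N k :
  `|psi_error (N %/ k) : R| <= 10 * (N%:R / k%:R).
Proof.
by apply: le_trans (psi_error_le _ _) _; rewrite ler_wpM2l // divn_le.
Qed.

Lemma selberg_error (R : realType) : exists C : R, 0 <= C /\
  forall N, `|psi_error N * ln N%:R +
    \sum_(1 <= n < N.+1) mangoldt n * psi_error (N %/ n)| <= C * N%:R.
Proof.
have [C [C0 hC]] := @selberg_formula R.
exists (C + 1); split => [|[|N]]; first by lra.
  by rewrite big_geq // ln0 // mulr0 addr0 normr0 mulr0.
have := hC N.+1 isT; have /andP[h1 h2] := @log_factE R N.+1 isT.
have h3 : \sum_(1 <= n < N.+2) mangoldt n * psi_error (N.+1 %/ n) =
  \sum_(1 <= n < N.+2) mangoldt n * psi (N.+1 %/ n) - log_fact N.+1 :> R.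
  rewrite -sum_mangoldt_floor -sumrB; apply: eq_bigr => n _.
  by rewrite /psi_error mulrBr.
have l := @ln_nat_le R N.+1; have n1 : 1 <= N.+1%:R :> R by rewrite ler1n.
rewrite h3 /psi_error !ler_norml.
move: h1 h2 l n1; set L := ln _; set S := \sum_(_ <= _ < _) _; set n := N.+1%:R.
by move=> h1 h2 l n1 /andP[h4 h5]; apply/andP; split; lra.
Qed.

Lemma psi_short_interval (R : realType) : exists C : R, 0 <= C /\
  forall m n, (0 < m)%N -> (m <= n)%N -> (n <= 2 * m)%N ->
  (psi n - psi m) * ln m%:R <= 2 * (n%:R - m%:R) * ln m%:R + C * n%:R.
Proof.
have [C [C0 hC]] := @selberg_formula R.
exists (2 * C + 2); split => [|m n m0 mn nm]; first by lra.
have n0 := leq_trans m0 mn.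
have := hC m m0; have := hC n n0.
have S : \sum_(1 <= k < m.+1) mangoldt k * psi (m %/ k) <=
         \sum_(1 <= k < n.+1) mangoldt k * psi (n %/ k) :> R.
  rewrite [leRHS](@big_cat_nat _ _ _ m.+1) //= -[leLHS]addr0; apply: lerD.
    by apply: ler_sum => k _; rewrite ler_wpM2l ?mangoldt_ge0 // ler_psi // leq_div2r.
  by apply: sumr_ge0 => k _; rewrite mulr_ge0 ?mangoldt_ge0 ?psi_ge0.
have rm0 : 0 < m%:R :> R by rewrite ltr0n.
have rn0 : 0 < n%:R :> R by rewrite ltr0n.
have rmn : m%:R <= n%:R :> R by rewrite ler_nat.
have l1 : ln m%:R <= ln n%:R :> R by rewrite ler_ln_nat.
have l2 : psi n * ln m%:R <= psi n * ln n%:R :> R by rewrite ler_wpM2l ?psi_ge0.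
have l3 : n%:R * (ln n%:R - ln m%:R) <= n%:R * 1 :> R.
  rewrite ler_wpM2l //; apply: le_trans (ln_sub_le rn0 rm0) _.
  have : n%:R / m%:R <= 2 :> R by rewrite ler_pdivrMr // -natrM ler_nat.
  by set q := _ / _; lra.
have Cm : C * m%:R <= C * n%:R by rewrite ler_wpM2l.
rewrite !ler_norml => /andP[_ h1] /andP[h2 _].
move: S l2 l3 Cm h1 h2; set Sm := \sum_(_ <= _ < _) _; set Sn := \sum_(_ <= _ < _) _.
lra.
Qed.

(** Summation by parts, where [h] majorises the variation of [g] and [g N.+1 = 0] removes the
    boundary term. It serves when only the partial sums of [e] are known to be small. *)
Lemma abel_sum_bound (R : realType) (e g h : nat -> R) C N :
  0 <= C -> g N.+1 = 0 -> 0 <= h N.+1 ->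
  (forall k, (0 < k <= N)%N -> `|\sum_(1 <= j < k.+1) e j| <= C * k%:R) ->
  (forall k, (0 < k <= N)%N -> `|g k - g k.+1| <= h k - h k.+1) ->
  `|\sum_(1 <= k < N.+1) e k * g k| <= C * \sum_(1 <= k < N.+1) h k.
Proof.
move=> C0 gN hN eC gh.
pose E k := \sum_(1 <= j < k.+1) e j.
have s1 n : \sum_(1 <= k < n.+1) e k * g k =
    E n * g n.+1 + \sum_(1 <= k < n.+1) E k * (g k - g k.+1).
  elim: n => [|n IH]; first by rewrite /E !big_geq // mul0r addr0.
  rewrite big_nat_recr //= IH [in RHS]big_nat_recr //=.
  have -> : E n.+1 = E n + e n.+1 by rewrite /E big_nat_recr.
  by ring.
have s2 n : \sum_(1 <= k < n.+1) k%:R * (h k - h k.+1) =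
    \sum_(1 <= k < n.+1) h k - n%:R * h n.+1.
  elim: n => [|n IH]; first by rewrite !big_geq // mul0r subr0.
  by rewrite big_nat_recr //= IH [in RHS]big_nat_recr //= -natr1; ring.
rewrite s1 gN mulr0 add0r; apply: le_trans (ler_norm_sum _ _ _) _.
apply: (@le_trans _ _ (C * \sum_(1 <= k < N.+1) k%:R * (h k - h k.+1))).
  rewrite mulr_sumr !big_nat; apply: ler_sum => k kN.
  by rewrite normrM mulrA ler_pM // ?eC ?gh.
by rewrite s2 ler_wpM2l // lerBlDr lerDl mulr_ge0.
Qed.

Definition mangoldt_conv {R : realType} (k : nat) : R :=
  \sum_(1 <= d < k.+1 | (d %| k)%N) mangoldt d * mangoldt (k %/ d).

(** Selberg's function, the Dirichlet convolution of [moebius] with the squared logarithm. Its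
    average near [k] is [2 * ln k]. *)
Definition selberg_weight {R : realType} (k : nat) : R :=
  mangoldt_conv k + mangoldt k * ln k%:R.

Lemma mangoldt_conv_ge0 (R : realType) k : 0 <= mangoldt_conv k :> R.
Proof. by apply: sumr_ge0 => d _; rewrite mulr_ge0 ?mangoldt_ge0. Qed.

Lemma sum_mangoldt_conv (R : realType) (f : nat -> R) N :
  \sum_(1 <= k < N.+1) mangoldt_conv k * f (N %/ k)%N =
  \sum_(1 <= m < N.+1) mangoldt m *
     \sum_(1 <= n < (N %/ m).+1) mangoldt n * f (N %/ m %/ n)%N.
Proof.
have := sum_divisors_hyperbola
  (fun d m => mangoldt d * mangoldt m * f (N %/ d %/ m)%N : R) N.
under [X in _ = X -> _]eq_bigr => d _ do
  under eq_bigr => m _ do rewrite -mulrA.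
under [X in _ = X -> _]eq_bigr => d _ do rewrite -mulr_sumr.
move=> <-; apply: eq_bigr => k _; rewrite /mangoldt_conv mulr_suml.
by apply: eq_bigr => d dk; rewrite -divnMA (mulnC d) divnK.
Qed.

Lemma sum_mangoldt_ln (R : realType) N :
  0 <= (psi N * ln N%:R - \sum_(1 <= k < N.+1) mangoldt k * ln k%:R : R) <= 10 * N%:R.
Proof.
elim: N => [|N /andP[IH1 IH2]]; first by rewrite big_geq // psi0 mul0r subr0 mulr0 lexx.
rewrite big_nat_recr //= psiS.
have -> : (psi N + mangoldt N.+1) * ln N.+1%:R -
  (\sum_(1 <= k < N.+1) mangoldt k * ln k%:R + mangoldt N.+1 * ln N.+1%:R) =
  (psi N * ln N%:R - \sum_(1 <= k < N.+1) mangoldt k * ln k%:R) +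
   psi N * (ln N.+1%:R - ln N%:R) :> R by ring.
case: N => [|N] in IH1 IH2 *.
  by rewrite [X in _ + X]mulrBr psi0 !mul0r subrr !addr0 big_geq // subr0 lexx mulr_ge0.
have d0 : 0 <= ln N.+2%:R - ln N.+1%:R :> R by rewrite subr_ge0 ler_ln_nat.
have h1 : 0 <= psi N.+1 * (ln N.+2%:R - ln N.+1%:R) :> R by rewrite mulr_ge0 // psi_ge0.
have h2 : psi N.+1 * (ln N.+2%:R - ln N.+1%:R) <= 10 :> R.
  apply: le_trans (ler_wpM2r d0 (psi_le R N.+1)) _.
  by have := @ln_succ_le R N.+1 isT; lra.
rewrite addr_ge0 //=; apply: le_trans (lerD IH2 h2) _.
by rewrite -[N.+2%:R]natr1; lra.
Qed.

Lemma sum_selberg_weight (R : realType) : exists C : R, 0 <= C /\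
  forall N, `|\sum_(1 <= k < N.+1) (selberg_weight k - 2 * ln k%:R)| <= C * N%:R.
Proof.
have [C [C0 hC]] := @selberg_formula R.
exists (C + 14); split => [|[|N]]; first by lra.
  by rewrite big_geq // normr0 mulr0.
have := hC N.+1 isT; have /andP[h1 h2] := @log_factE R N.+1 isT.
have /andP[h3 h4] := @sum_mangoldt_ln R N.+1.
have l := @ln_nat_le R N.+1; have n1 : 1 <= N.+1%:R :> R by rewrite ler1n.
have e : \sum_(1 <= k < N.+2) mangoldt_conv k =
    \sum_(1 <= k < N.+2) mangoldt k * psi (N.+1 %/ k) :> R.
  have := @sum_mangoldt_conv R (fun=> 1) N.+1.
  under eq_bigr => k _ do rewrite mulr1.
  by under [X in _ = X -> _]eq_bigr => k _ do under eq_bigr => m _ do rewrite mulr1.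
have -> : \sum_(1 <= k < N.+2) (selberg_weight k - 2 * ln k%:R) =
  \sum_(1 <= k < N.+2) mangoldt_conv k +
  \sum_(1 <= k < N.+2) mangoldt k * ln k%:R - 2 * log_fact N.+1 :> R.
  by rewrite sumrB big_split /= mulr_sumr.
rewrite e !ler_norml.
move: h1 h2 h3 h4 l n1; set L := ln _; set n := N.+1%:R.
set S := \sum_(_ <= _ < _) _ * ln _; set T := \sum_(_ <= _ < _) _.
by move=> h1 h2 h3 h4 l n1 /andP[h5 h6]; apply/andP; split; lra.
Qed.

(** Selberg's formula for [psi_error] at [N], times [ln N], is combined with the formulas at
    [N %/ m] weighted by [mangoldt m]. The single sums combine into one with weight
    [mangoldt k * ln k], of sign opposite to the double sum; absolute values make both weights add
    up to [selberg_weight]. *)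
Lemma psi_error_selberg_weight (R : realType) : exists C : R, 0 <= C /\
  forall N, (0 < N)%N -> `|psi_error N| * ln N%:R ^+ 2 <=
    \sum_(1 <= k < N.+1) selberg_weight k * `|psi_error (N %/ k)| +
    C * N%:R * (ln N%:R + 1).
Proof.
have [C [C0 hC]] := @selberg_error R.
exists (13 * C + 120); split => [|N N0]; first by lra.
have n0 : 0 < N%:R :> R by rewrite ltr0n.
have l0 := @ln_nat_ge0 R N.
have S0 := @sum_mangoldt_div_le R N N0.
pose f (M : nat) : R := psi_error M.
pose T m : R := f (N %/ m)%N * ln (N %/ m)%:R +
   \sum_(1 <= n < (N %/ m).+1) mangoldt n * f (N %/ m %/ n)%N.
have bT : `|\sum_(1 <= m < N.+1) mangoldt m * T m| <= C * (N%:R * (ln N%:R + 12)).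
  apply: le_trans (ler_norm_sum _ _ _) _.
  apply: (@le_trans _ _ (C * (N%:R * \sum_(1 <= d < N.+1) mangoldt d / d%:R))); last first.
    by rewrite ler_wpM2l // ler_wpM2l // ltW.
  rewrite !mulr_sumr; apply: ler_sum => m _.
  rewrite normrM ger0_norm ?mangoldt_ge0 //.
  have -> : C * (N%:R * (mangoldt m / m%:R)) = mangoldt m * (C * (N%:R / m%:R)) by ring.
  rewrite ler_wpM2l ?mangoldt_ge0 // (le_trans (hC _)) // ler_wpM2l //.
  exact: divn_le.
pose X : R := \sum_(1 <= k < N.+1) mangoldt_conv k * f (N %/ k)%N.
pose Z : R := \sum_(1 <= k < N.+1) mangoldt k * ln k%:R * f (N %/ k)%N.
pose A : R := \sum_(1 <= k < N.+1) mangoldt k * f (N %/ k)%N.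
pose Y : R := \sum_(1 <= k < N.+1) mangoldt k * (f (N %/ k)%N * ln (N %/ k)%:R).
have TXY : \sum_(1 <= m < N.+1) mangoldt m * T m = Y + X.
  by rewrite /X sum_mangoldt_conv -big_split; apply: eq_bigr => m _; rewrite /= -mulrDr.
(* This is the cost of rounding: [ln N - ln k - ln (N %/ k)] lies between 0 and 1 instead of being
   0. *)
have bY : `|ln N%:R * A - Z - Y| <= 10 * (N%:R * (ln N%:R + 12)).
  rewrite mulr_sumr -!sumrB; apply: le_trans (ler_norm_sum _ _ _) _.
  apply: (@le_trans _ _ (10 * (N%:R * \sum_(1 <= d < N.+1) mangoldt d / d%:R))); last first.
    by rewrite ler_wpM2l // ler_wpM2l // ltW.
  rewrite !mulr_sumr !big_nat; apply: ler_sum => k /andP[k0 kN].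
  have -> : ln N%:R * (mangoldt k * f (N %/ k)%N) - mangoldt k * ln k%:R * f (N %/ k)%N
     - mangoldt k * (f (N %/ k)%N * ln (N %/ k)%:R) =
     mangoldt k * (f (N %/ k)%N * (ln N%:R - ln k%:R - ln (N %/ k)%:R)) by ring.
  have -> : 10 * (N%:R * (mangoldt k / k%:R)) = mangoldt k * (10 * (N%:R / k%:R) * 1) :> R by ring.
  rewrite normrM ger0_norm ?mangoldt_ge0 // ler_wpM2l ?mangoldt_ge0 // normrM.
  apply: ler_pM => //; first exact: psi_error_div_le.
  have /andP[b1 b2] := @ln_divn_bounds R N k (introT andP (conj k0 kN)).
  by rewrite ger0_norm; lra.
have bA := hC N; rewrite -/(f N) -/A in bA.
have e : f N * ln N%:R ^+ 2 = ln N%:R * (f N * ln N%:R + A)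
   - (\sum_(1 <= m < N.+1) mangoldt m * T m) - (ln N%:R * A - Z - Y) + (X - Z).
  by rewrite TXY; ring.
have bXZ : `|X - Z| <= \sum_(1 <= k < N.+1) selberg_weight k * `|f (N %/ k)%N|.
  rewrite /X /Z -sumrB; apply: le_trans (ler_norm_sum _ _ _) _.
  apply: ler_sum => k _; rewrite -mulrBl normrM ler_wpM2r //.
  apply: le_trans (ler_normB _ _) _; rewrite !ger0_norm //.
    by rewrite mulr_ge0 ?mangoldt_ge0 ?ln_nat_ge0.
  exact: mangoldt_conv_ge0.
have -> : `|psi_error N| * ln N%:R ^+ 2 = `|f N * ln N%:R ^+ 2|.
  by rewrite normrM [X in _ = _ * X]ger0_norm // exprn_ge0.
rewrite e; apply: le_trans (ler_normD _ _) _.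
rewrite addrC; apply: lerD => //.
apply: le_trans (ler_normB _ _) _.
apply: le_trans (lerD (ler_normB _ _) bY) _.
apply: le_trans (lerD (lerD (lexx _) bT) (lexx _)) _.
rewrite normrM (ger0_norm l0).
have := ler_wpM2l l0 bA.
have := mulr_ge0 (mulr_ge0 C0 (ltW n0)) l0; have := mulr_ge0 C0 (ltW n0).
have := mulr_ge0 (ltW n0) l0.
set w := _ * `|_|; set n := N%:R; set l := ln _; lra.
Qed.

(** The weight is replaced by its average through [abel_sum_bound]. The variation in [k] of the
    absolute error at [N %/ k] is majorised by that of [psi (N %/ k) + N %/ k], which is monotone
    and whose sum is [O(N * ln N)]. *)
Lemma selberg_log_square (R : realType) : exists C : R, 0 <= C /\
  forall N, (0 < N)%N -> `|psi_error N| * ln N%:R ^+ 2 <=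
    2 * \sum_(1 <= k < N.+1) ln k%:R * `|psi_error (N %/ k)| +
    C * N%:R * (ln N%:R + 1).
Proof.
have [C [C0 hC]] := @psi_error_selberg_weight R.
have [D [D0 hD]] := @sum_selberg_weight R.
exists (C + 11 * D); split => [|N N0]; first by lra.
apply: le_trans (hC N N0) _.
have := @abel_sum_bound R (fun k => selberg_weight k - 2 * ln k%:R)
   (fun k => `|psi_error (N %/ k)|) (fun k => psi (N %/ k) + (N %/ k)%:R) D N D0.
rewrite divn_small // /psi_error psi0 subr0 normr0 add0r => /(_ erefl (lexx _) (fun k _ => hD k)) h.
have {h} := h _; have gh k : (0 < k <= N)%N ->
  `| `|psi (N %/ k) - (N %/ k)%:R| - `|psi (N %/ k.+1) - (N %/ k.+1)%:R| | <=
   psi (N %/ k) + (N %/ k)%:R - (psi (N %/ k.+1) + (N %/ k.+1)%:R) :> R.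
  move=> /andP[k0 kN]; apply: le_trans (ler_dist_dist _ _) _.
  have d : (N %/ k.+1 <= N %/ k)%N by rewrite leq_div2l.
  have := @ler_psi R _ _ d; have : (N %/ k.+1)%:R <= (N %/ k)%:R :> R by rewrite ler_nat.
  by move=> h1 h2; rewrite ler_norml; apply/andP; split; lra.
move=> /(_ gh) h.
have H : \sum_(1 <= k < N.+1) (psi (N %/ k) + (N %/ k)%:R) <= 11 * (N%:R * (ln N%:R + 1)) :> R.
  apply: (@le_trans _ _ (11 * (N%:R * harmonic_sum N))); last first.
    by rewrite ler_wpM2l // ler_wpM2l // harmonic_sum_le.
  rewrite !mulr_sumr; apply: ler_sum => k _.
  by have := @psi_le R (N %/ k); have := divn_le R N k; lra.
have {}H := ler_wpM2l D0 H; have {h H} := le_trans h H.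
under eq_bigr => k _ do rewrite mulrBl.
rewrite sumrB ler_norml => /andP[_].
under [X in _ - X]eq_bigr => k _ do rewrite -mulrA.
rewrite -mulr_sumr -!/(psi_error _).
set a := \sum_(_ <= _ < _) _; set b := \sum_(_ <= _ < _) _; lra.
Qed.

(** * The prime number theorem *)

Lemma nat_above (R : realType) (x : R) : exists n : nat, x < n%:R.
Proof.
exists (Num.truncn `|x|).+1; apply: le_lt_trans (ler_norm x) _.
by have /andP[] := truncn_itv (normr_ge0 x).
Qed.

Lemma ln_nat_large (R : realType) (K : R) :
  exists M, forall n, (M <= n)%N -> K <= ln n%:R.
Proof.
have [M hM] := nat_above (expR K); exists M => n Mn.
have n0 : 0 < n%:R :> R by apply: lt_le_trans (expR_gt0 K) _; rewrite ltW // (lt_le_trans hM) // ler_nat.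
rewrite -[K]expRK ler_ln ?posrE ?expR_gt0 //.
by rewrite ltW // (lt_le_trans hM) // ler_nat.
Qed.

Lemma ln_nat_small (R : realType) (a : R) : 0 < a ->
  exists M, (0 < M)%N /\ forall n, (M <= n)%N -> ln n%:R <= a * n%:R.
Proof.
move=> a0; have [M hM] := nat_above ((16 / a) ^+ 2); exists M.+1; split=> // n Mn.
have n0 : (0 < n)%N by apply: leq_trans Mn.
set s : R := Num.sqrt n%:R; have s0 : 0 < s by rewrite sqrtr_gt0 ltr0n.
have ss : s ^+ 2 = n%:R by rewrite sqr_sqrtr.
have l0 := @ln_nat_ge0 R n; have := @sqr_ln_le_sqrt R n n0; rewrite -/s => h.
have sa : 16 / a <= s.
  rewrite -(@ler_pXn2r _ 2) ?nnegrE ?ss ?(ltW s0) ?divr_ge0 ?(ltW a0) //.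
  by rewrite ltW // (lt_le_trans hM) // ler_nat ltnW.
move: sa; rewrite ler_pdivrMr // => sa.
have sas : 16 * s <= s * a * s by rewrite ler_pM2r.
have l1 : ln n%:R <= 16 * s by apply: le_trans h; move: l0; set l := ln _; nra.
by rewrite (le_trans l1) // -ss; move: sas; rewrite expr2; lra.
Qed.

Lemma harmonic_sum_ge (R : realType) N : ln N.+1%:R <= harmonic_sum N :> R.
Proof.
elim: N => [|N IH]; first by rewrite ln1 /harmonic_sum big_geq.
rewrite /harmonic_sum big_nat_recr //= -/(harmonic_sum N).
have := @ln_succ_le R N.+1 isT; rewrite mulrC -ler_pdivlMr ?ltr0n // div1r.
set i := _^-1; lra.
Qed.

(** Discrete form of the boundedness of the integral of [(psi t - t) / t ^ 2]. Summation by parts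
    turns the [psi] part into the sum of [mangoldt m / m], and the rest is a harmonic sum; both
    equal a logarithm up to a bounded error. *)
Lemma sum_psi_error_le (R : realType) N :
  `|\sum_(1 <= m < N.+1) psi_error m / (m%:R * m.+1%:R)| <= 30 :> R.
Proof.
case: N => [|N]; first by rewrite big_geq // normr0.
have s1 n : \sum_(1 <= m < n.+1) psi m / (m%:R * m.+1%:R) =
  \sum_(1 <= m < n.+1) mangoldt m / m%:R - psi n / n.+1%:R :> R.
  elim: n => [|n IH]; first by rewrite !big_geq // psi0 mul0r subr0.
  rewrite big_nat_recr //= IH [in RHS]big_nat_recr //= psiS.
  have -> : n.+2%:R = n.+1%:R + 1 :> R by rewrite natr1.
  have n0 : 0 < n.+1%:R :> R by rewrite ltr0n.
  set x := n.+1%:R in n0 *.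
  by field; rewrite !gt_eqF //; lra.
have s2 n : \sum_(1 <= m < n.+1) m%:R / (m%:R * m.+1%:R) = harmonic_sum n.+1 - 1 :> R.
  elim: n => [|n IH]; first by rewrite big_geq // /harmonic_sum big_nat1 invr1 subrr.
  rewrite big_nat_recr //= IH /harmonic_sum [in RHS]big_nat_recr //= addrAC.
  by congr (_ + _); rewrite invfM mulrA divff ?mul1r.
have -> : \sum_(1 <= m < N.+2) psi_error m / (m%:R * m.+1%:R) =
  (\sum_(1 <= m < N.+2) mangoldt m / m%:R - psi N.+1 / N.+2%:R) - (harmonic_sum N.+2 - 1) :> R.
  by rewrite -s1 -s2 -sumrB; apply: eq_bigr => m _; rewrite -mulrBl.
have n2 : 0 < N.+2%:R :> R by rewrite ltr0n.
have h1 : 0 <= psi N.+1 / N.+2%:R :> R by rewrite divr_ge0 ?psi_ge0.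
have h2 : psi N.+1 / N.+2%:R <= 10 :> R.
  rewrite ler_pdivrMr // (le_trans (psi_le _ _)) // ler_wpM2l // ler_nat //.
have := @mertens R N.+1 isT; rewrite ler_norml => /andP[h3 h4].
have h5 := @harmonic_sum_ge R N.+2; have h6 := @harmonic_sum_le R N.+2 isT.
have h7 : ln N.+2%:R <= ln N.+3%:R :> R by rewrite ler_ln_nat.
have h8 : ln N.+1%:R <= ln N.+2%:R :> R by rewrite ler_ln_nat.
have h9 : ln N.+2%:R <= ln N.+1%:R + 1 :> R.
  have := @ln_succ_le R N.+1 isT; rewrite mulrC -ler_pdivlMr ?ltr0n // div1r.
  have : N.+1%:R^-1 <= 1 :> R by rewrite invf_le1 ?ltr0n // ler1n.
  set i := _^-1; lra.
move: h1 h2; set q := psi _ / _ => h1 h2.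
by rewrite ler_norml; apply/andP; split; lra.
Qed.

(** If the error exceeded [a * m] in absolute value throughout a long interval, it would keep its
    sign there. The sum of [psi_error m / (m * (m + 1))] over that interval would then exceed 60,
    twice the bound in [sum_psi_error_le]. *)
Lemma psi_error_small_value (R : realType) (a : R) : 0 < a ->
  exists B M1, (1 < B)%N /\ forall M, (M1 <= M)%N ->
    exists m, (M <= m <= B * M)%N /\ `|psi_error m| <= a * m%:R.
Proof.
move=> a0.
have a20 : 0 < a / 2 by rewrite divr_gt0.
have [M2 [M20 hM2]] := ln_nat_small a20.
have [M3 hM3] := nat_above (2 / a).
have [b hb] := nat_above (expR (60 / a)).
have b0 : 0 < b%:R :> R by apply: lt_trans hb; exact: expR_gt0.
have lb : 60 / a < ln b%:R by rewrite -[X in X < _]expRK ltr_ln ?posrE ?expR_gt0.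
(* The factor 2 gives [b * (M + 1) <= 2 * b * M + 1], so that the logarithmic length of the interval
   is at least [ln b]. *)
exists (2 * b)%N, (M2 + M3)%N; split.
  by rewrite ltr0n in b0; lia.
move=> M MM; apply: contrapT => H.
have big m : (M <= m <= 2 * b * M)%N -> a * m%:R < `|psi_error m|.
  by move=> hm; rewrite ltNge; apply/negP => hle; apply: H; exists m.
have M0 : (0 < M)%N by lia.
have am m : (M <= m)%N -> 2 <= a * m%:R.
  move=> Mm; rewrite mulrC -ler_pdivrMr //; apply/ltW/(lt_le_trans hM3).
  by rewrite ler_nat; lia.
have lnm m : (M <= m)%N -> ln m.+1%:R <= a * m%:R.
  move=> Mm; apply: (le_trans (hM2 m.+1 _)); first by lia.
  have : a * 1 <= a * m%:R by rewrite ler_pM2l // ler1n; lia.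
  by rewrite -[m.+1%:R]natr1; lra.
have step m : psi_error m.+1 = psi_error m + mangoldt m.+1 - 1 :> R.
  by rewrite /psi_error psiS -natr1; ring.
have bM1 : (1 <= b)%N by rewrite ltr0n in b0.
have MbM : (M <= 2 * b * M)%N by rewrite leq_pmull; lia.
(* A downward step is at most 1 while [a * m >= 2], and an upward step is below [ln m.+1 <= a * m];
   neither leads across 0. *)
have sgn : exists s : R, [/\ `|s| = 1 & forall m, (M <= m <= 2 * b * M)%N ->
     a * m%:R < s * psi_error m].
  have [pos|neg] := ltP 0 (psi_error M : R).
    exists 1; split=> [|m]; first by rewrite normr1.
    rewrite mul1r; elim: m => [|m IH] hm; first by lia.
    have hb1 := big m.+1 hm.
    have [->|Mm] := eqVneq m.+1 M; first by rewrite -[ltRHS]gtr0_norm // big //; lia.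
    have {}IH : a * m%:R < psi_error m by apply: IH; lia.
    have p1 : 0 < psi_error m.+1 :> R.
      have ml := @mangoldt_ge0 R m.+1.
      have Mm' : (M <= m)%N by lia.
      by have := am m Mm'; rewrite step; lra.
    by rewrite -(gtr0_norm p1).
  exists (-1); split=> [|m]; first by rewrite normrN normr1.
  rewrite mulN1r; elim: m => [|m IH] hm; first by lia.
  have hb1 := big m.+1 hm.
  have [->|Mm] := eqVneq m.+1 M; first by rewrite -(ler0_norm neg) big //; lia.
  have {}IH : a * m%:R < - psi_error m by apply: IH; lia.
  have p1 : psi_error m.+1 <= 0 :> R.
    have ml := @mangoldt_le_ln R m.+1.
    have Mm' : (M <= m)%N by lia.
    by have := lnm m Mm'; rewrite step; lra.
  by rewrite -(ler0_norm p1).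
case: sgn => s [s1 hs].
pose F m : R := psi_error m / (m%:R * m.+1%:R).
have up : `|\sum_(M <= m < 2 * b * M) F m| <= 60.
  have e : \sum_(M <= m < 2 * b * M) F m =
      \sum_(1 <= m < (2 * b * M).-1.+1) F m - \sum_(1 <= m < M.-1.+1) F m.
    rewrite !prednK //; last by lia.
    by rewrite (@big_cat_nat _ _ _ M 1 (2 * b * M)) //= addrAC subrr add0r.
  rewrite e; apply: le_trans (ler_normB _ _) _.
  by have := @sum_psi_error_le R (2 * b * M).-1; have := @sum_psi_error_le R M.-1; rewrite -!/(F _); lra.
have low : a * (ln (2 * b * M).+1%:R - ln M.+1%:R) <= s * \sum_(M <= m < 2 * b * M) F m.
  rewrite -(telescope_sumr (fun k => ln k.+1%:R : R) MbM).
  rewrite !mulr_sumr !big_nat; apply: ler_sum => k /andP[Mk kb].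
  have k0 : (0 < k)%N by lia.
  have rk0 : 0 < k%:R :> R by rewrite ltr0n.
  have h1 := @ln_succ_le R k.+1 isT.
  have h2 : a * k%:R < s * psi_error k by apply: hs; lia.
  rewrite /F mulrA ler_pdivlMr ?mulr_gt0 ?ltr0n //.
  have : a * k%:R * (k.+1%:R * (ln k.+2%:R - ln k.+1%:R)) <= a * k%:R * 1.
    by rewrite ler_wpM2l // mulr_ge0 // ltW.
  lra.
have low2 : ln b%:R <= ln (2 * b * M).+1%:R - ln M.+1%:R :> R.
  rewrite lerBrDr -lnM ?posrE ?ltr0n // -natrM ler_ln_nat //; first by rewrite muln_gt0 bM1.
  nia.
have : s * \sum_(M <= m < 2 * b * M) F m <= 60.
  by rewrite (le_trans (ler_norm _)) // normrM s1 mul1r.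
have : 60 < a * ln b%:R by rewrite mulrC -ltr_pdivrMr.
have := ler_wpM2l (ltW a0) low2.
lra.
Qed.

(** From a point [m] with error at most [a / 4 * m], moving right by at most [a / 16 * m] changes
    the error little: downwards because [psi] is monotone, upwards by [psi_short_interval]. *)
Lemma psi_error_small_window (R : realType) (a : R) : 0 < a -> a <= 1 ->
  exists B M1, (1 < B)%N /\ forall M, (M1 <= M)%N ->
    exists m, (M <= m <= B * M)%N /\
      forall n, (m <= n)%N -> n%:R <= (1 + a / 16) * m%:R ->
        `|psi_error n| <= a / 2 * n%:R.
Proof.
move=> a0 a1; have a4 : 0 < a / 4 by rewrite divr_gt0.
have [B [M1 [B1 hB]]] := psi_error_small_value a4.
have [C [C0 hC]] := @psi_short_interval R.
have [M2 hM2] := ln_nat_large (16 * C / a + 1).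
exists B, (M1 + M2 + 1)%N; split=> // M MM.
have [|m [hm em]] := hB M; first by lia.
exists m; split=> // n mn nm.
have m0 : (0 < m)%N by lia.
have rm0 : 0 < m%:R :> R by rewrite ltr0n.
have rmn : m%:R <= n%:R :> R by rewrite ler_nat.
have n2m : (n <= 2 * m)%N.
  by rewrite -(ler_nat R) natrM (le_trans nm) // ler_pM2r //; lra.
have := hC m n m0 mn n2m.
have : 16 * C / a + 1 <= ln m%:R by apply: hM2; lia.
set L := ln m%:R => hL h.
have Ca : 0 <= 16 * C / a by rewrite divr_ge0 ?mulr_ge0 // ltW.
have L0 : 0 < L by lra.
have CL : C <= a / 16 * L.
  have : 16 * C / a <= L by lra.
  by rewrite ler_pdivrMr //; lra.
have h2 : psi n - psi m <= 2 * (n%:R - m%:R) + a / 16 * n%:R.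
  rewrite -(ler_pM2r L0) [leRHS]mulrDl (le_trans h) // lerD2l.
  by rewrite mulrAC ler_wpM2r.
have h3 := @ler_psi R m n mn.
move: em; rewrite /psi_error !ler_norml => /andP[e1 e2].
have an : a / 4 * m%:R <= a / 4 * n%:R by rewrite ler_wpM2l // ltW.
have an' : a / 16 * m%:R <= a / 16 * n%:R by rewrite ler_wpM2l // divr_ge0 // ltW.
by apply/andP; split; lra.
Qed.

Lemma big_nat_sub_ge (R : realType) (F : nat -> R) a b c d :
  (forall k, 0 <= F k) -> (a <= b)%N -> (d <= c)%N ->
  \sum_(b <= k < d) F k <= \sum_(a <= k < c) F k.
Proof.
move=> F0 ab dc; have [db|bd] := leqP d b.
  by rewrite big_geq // sumr_ge0.
rewrite [leRHS](@big_cat_nat _ _ _ b) //=; last by lia.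
rewrite [X in _ + X](@big_cat_nat _ _ _ d) //=; last by lia.
by rewrite addrCA lerDl addr_ge0 ?sumr_ge0.
Qed.

(** For a window starting at [m], every integer [k] between [z = N / ((1 + kappa) * m)] and
    [N / m = (1 + kappa) * z] has [N %/ k] in the window. There are at least
    [kappa * z - 1 >= kappa * z / 2] of them, with reciprocals at least [1 / (2 * z)]. *)
Lemma window_block_sum (R : realType) (P : pred nat) (kappa : R) B M1 N y :
  0 < kappa -> kappa <= 1 -> (1 < B)%N ->
  (forall M, (M1 <= M)%N -> exists m, (M <= m <= B * M)%N /\
      forall n, (m <= n)%N -> n%:R <= (1 + kappa) * m%:R -> P n) ->
  2 / kappa <= y%:R -> (y * B ^ 3 * M1.+1 <= N)%N ->
  kappa / 4 <= \sum_(y <= k < y * B ^ 3) (if P (N %/ k)%N then k%:R^-1 else 0) :> R.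
Proof.
move=> k0 k1 B1 hP yk yN.
have y0 : (0 < y)%N.
  by rewrite -(ltr0n R); apply: lt_le_trans yk; rewrite divr_gt0.
set D := (y * B ^ 3)%N in yN *.
have D0 : (0 < D)%N by rewrite muln_gt0 y0 expn_gt0 (ltnW B1).
set M := (N %/ D).+1.
have qM1 : (M1.+1 <= N %/ D)%N by rewrite leq_divRL // mulnC.
have [|m [/andP[Mm mB] hm]] := hP M; first by rewrite /M; lia.
have m0 : (0 < m)%N by rewrite (leq_trans _ Mm).
have rm0 : 0 < m%:R :> R by rewrite ltr0n.
have N0 : (0 < N)%N by apply: leq_trans yN; rewrite muln_gt0 D0.
have rN0 : 0 < N%:R :> R by rewrite ltr0n.
have NMD : (N < M * D)%N by rewrite /M ltn_ceil.
set z : R := N%:R / ((1 + kappa) * m%:R).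
have q0 : 0 < 1 + kappa by lra.
have z0 : 0 < z by rewrite divr_gt0 // mulr_gt0.
have zN : (1 + kappa) * z * m%:R = N%:R.
  by rewrite /z; field; rewrite !gt_eqF //; lra.
(* Here [m <= B * M] with [M] about [N / D]. Rounding and the factor [1 + kappa] cost 2 each, and
   [4 <= B ^ 2] absorbs them; hence the block ratio [B ^ 3]. *)
have yz : y%:R <= z.
  rewrite /z ler_pdivlMr ?mulr_gt0 //.
  apply: (@le_trans _ _ (2 * (y%:R * m%:R))).
    rewrite mulrCA ler_wpM2r ?mulr_ge0 //; lra.
  rewrite -!natrM ler_nat.
  have h1 : ((N %/ D) * (y * B ^ 3) <= N)%N by exact: leq_trunc_div.
  have h2 : (B * M <= 2 * (B * (N %/ D)))%N by rewrite /M; nia.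
  have h3 : (4 <= B ^ 2)%N by rewrite -[4%N]/(2 ^ 2)%N leq_exp2r.
  apply: leq_trans h1.
  have h4 : (m <= 2 * (B * (N %/ D)))%N by lia.
  apply: (@leq_trans (2 * (y * (2 * (B * (N %/ D)))))%N); first by rewrite !leq_mul.
  have -> : (N %/ D * (y * B ^ 3) = B ^ 2 * (y * (B * (N %/ D))))%N.
    by rewrite (expnS B 2); lia.
  have -> : (2 * (y * (2 * (B * (N %/ D)))) = 4 * (y * (B * (N %/ D))))%N by lia.
  by rewrite leq_mul.
set lo := (Num.truncn z).+1.
have /andP[lo1 lo2] := truncn_itv (ltW z0).
set hi := (N %/ m)%N.
have hiD : (hi < D)%N.
  rewrite /hi ltn_divLR //; apply: leq_trans NMD _.
  by rewrite mulnC leq_mul.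
have ylo : (y <= lo)%N.
  by rewrite -(ler_nat R) (le_trans yz) // ltW.
apply: (@le_trans _ _ (\sum_(lo <= k < hi.+1) (if P (N %/ k)%N then k%:R^-1 else 0))); last first.
  by apply: big_nat_sub_ge => // k; case: ifP => // _; rewrite invr_ge0.
have hz : (1 + kappa) * z < hi%:R + 1.
  by rewrite -(ltr_pM2r rm0) zN natr1 -natrM ltr_nat /hi ltn_ceil.
apply: (@le_trans _ _ (\sum_(lo <= k < hi.+1) ((1 + kappa) * z)^-1)); last first.
  rewrite !big_nat; apply: ler_sum => k /andP[lok khi].
  have kpos : (0 < k)%N by apply: leq_trans lok.
  have kN : (k * m <= N)%N by rewrite -leq_divRL.
  have zk : z <= k%:R by rewrite ltW // (lt_le_trans lo2) // ler_nat.
  have -> : P (N %/ k)%N.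
    apply: hm; first by rewrite leq_divRL // mulnC.
    apply: le_trans (divn_le _ _ _) _; rewrite ler_pdivrMr ?ltr0n //.
    by rewrite -zN mulrAC ler_wpM2l // mulr_ge0 //; lra.
  rewrite lef_pV2 ?posrE ?ltr0n ?(mulr_gt0 q0 z0) //.
  by rewrite -(ler_pM2r rm0) zN -natrM ler_nat.
rewrite sumr_const_nat -[leRHS]mulr_natl.
have cnt : kappa * z - 1 <= (hi.+1 - lo)%:R.
  have : hi.+1%:R <= (hi.+1 - lo)%:R + lo%:R :> R by rewrite -natrD ler_nat addnC -leq_subLR.
  rewrite -[hi.+1%:R]natr1 -[lo%:R]natr1; lra.
rewrite ler_pdivlMr ?(mulr_gt0 q0 z0) //; apply: le_trans cnt.
have kz : 2 <= kappa * z.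
  by move: yk; rewrite ler_pdivrMr // => yk; have : y%:R * kappa <= z * kappa; [rewrite ler_pM2r|lra].
have : kappa * (kappa * z) <= 1 * (kappa * z) by rewrite ler_wpM2r; lra.
lra.
Qed.

(** The previous bound is applied to the [J] blocks from [D ^ i] to [D ^ i.+1] with
    [J <= i < 2 * J], where [4 * J] is about the logarithm of [N] in base [D]. On them
    [ln k >= J * ln D], so each block contributes a multiple of [J]. *)
Lemma window_log_sum (R : realType) (P : pred nat) (kappa : R) B M1 :
  0 < kappa -> kappa <= 1 -> (1 < B)%N ->
  (forall M, (M1 <= M)%N -> exists m, (M <= m <= B * M)%N /\
      forall n, (m <= n)%N -> n%:R <= (1 + kappa) * m%:R -> P n) ->
  exists c : R, 0 < c /\ exists N0, forall N, (N0 <= N)%N ->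
    c * ln N%:R ^+ 2 <=
    \sum_(1 <= k < N.+1) (if P (N %/ k)%N then ln k%:R / k%:R else 0).
Proof.
move=> k0 k1 B1 hP; set D := (B ^ 3)%N.
have D1 : (1 < D)%N by rewrite -(exp1n 3) ltn_exp2r.
have D0 : (0 < D)%N by lia.
have lD : 0 < ln D%:R :> R by rewrite ln_gt0 // ltr1n.
have [J1 hJ1] := nat_above (2 / kappa).
set J0 := (J1 + M1.+2)%N.
(* The blocks yield [J ^ 2 * ln D * kappa / 4], and [ln N <= 8 * J * ln D]; thus 256 is
   [4 * 8 ^ 2]. *)
exists (kappa / (256 * ln D%:R)); split; first by rewrite divr_gt0 ?mulr_gt0.
exists (D ^ (4 * J0))%N => N hN.
have N0 : (0 < N)%N by apply: leq_trans hN; rewrite expn_gt0 D0.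
set I := trunc_log D N; set J := (I %/ 4)%N.
have I0 : (4 * J0 <= I)%N by apply: trunc_log_max.
have JJ0 : (J0 <= J)%N by rewrite /J leq_divRL // mulnC.
have DIN : (D ^ (4 * J) <= N)%N.
  by apply: leq_trans (trunc_logP D1 N0); rewrite leq_exp2l // mulnC leq_trunc_div.
have DJ : (J < D ^ J)%N by rewrite ltn_expl.
have lnN : ln N%:R <= 8 * J%:R * ln D%:R :> R.
  apply: (@le_trans _ _ (ln (D ^ I.+1)%:R)).
    by rewrite ler_ln_nat // ltnW // trunc_log_ltn.
  rewrite natrX lnXn ?ltr0n // -[leLHS]mulr_natl ler_wpM2r ?(ltW lD) //.
  rewrite -natrM ler_nat; rewrite /J0 in JJ0; rewrite /J in JJ0 *; lia.
pose F k : R := if P (N %/ k)%N then ln k%:R / k%:R else 0.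
have F0 k : 0 <= F k.
  by rewrite /F; case: ifP => // _; rewrite divr_ge0 // ln_nat_ge0.
have block i : (J <= i < 2 * J)%N ->
    J%:R * ln D%:R * (kappa / 4) <= \sum_(D ^ i <= k < D ^ i.+1) F k.
  move=> /andP[Ji i2J].
  have Di : (D ^ J <= D ^ i)%N by rewrite leq_exp2l.
  have := @window_block_sum R P kappa B M1 N (D ^ i) k0 k1 B1 hP.
  rewrite -/D -expnSr => h; have {h} h : kappa / 4 <=
     \sum_(D ^ i <= k < D ^ i.+1) (if P (N %/ k)%N then k%:R^-1 else 0).
    apply: h.
      by rewrite ltW // (lt_le_trans hJ1) // ler_nat; rewrite /J0 in JJ0; lia.
    apply: leq_trans DIN; apply: (@leq_trans (D ^ (2 * J) * D ^ J)%N).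
      by rewrite leq_mul // ?leq_exp2l //; rewrite /J0 in JJ0; lia.
    by rewrite -expnD leq_exp2l //; lia.
  apply: le_trans (ler_wpM2l _ h) _; first by rewrite mulr_ge0 // ltW.
  rewrite mulr_sumr !big_nat; apply: ler_sum => k /andP[ik ki].
  rewrite /F; case: ifP => _; last by rewrite mulr0.
  rewrite ler_wpM2r ?invr_ge0 // mulr_natl -lnXn ?ltr0n // -natrX ler_ln_nat //.
    by rewrite expn_gt0 D0.
  by apply: leq_trans ik.
have blocks n : (n <= J)%N ->
    n%:R * (J%:R * ln D%:R * (kappa / 4)) <= \sum_(D ^ J <= k < D ^ (J + n)) F k.
  elim: n => [|n IH] nJ; first by rewrite mul0r sumr_ge0.
  rewrite (@big_cat_nat _ _ _ (D ^ (J + n))) /= ?leq_exp2l ?leq_addr //; last by lia.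
  rewrite -natr1 mulrDl mul1r lerD ?IH //; first by lia.
  by rewrite addnS block //; lia.
apply: (@le_trans _ _ (J%:R * (J%:R * ln D%:R * (kappa / 4)))); last first.
  apply: le_trans (blocks J (leqnn _)) _; apply: big_nat_sub_ge => //.
    by rewrite expn_gt0 D0.
  by rewrite ltnW // ltnS (leq_trans _ DIN) // leq_exp2l //; lia.
have l0 := @ln_nat_ge0 R N.
apply: (@le_trans _ _ (kappa / (256 * ln D%:R) * (8 * J%:R * ln D%:R) ^+ 2)).
  rewrite ler_wpM2l ?divr_ge0 ?mulr_ge0 ?(ltW k0) ?(ltW lD) //.
  by rewrite ler_sqr ?nnegrE // !mulr_ge0 // ltW.
rewrite le_eqVlt; apply/orP; left; apply/eqP.
by field; rewrite gt_eqF.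
Qed.

(** The term [- 1 / N] strengthens the claim so that the induction absorbs the second-order error of
    each step. *)
Lemma sum_ln_div_le (R : realType) N : (0 < N)%N ->
  \sum_(1 <= k < N.+1) ln k%:R / k%:R <= ln N%:R ^+ 2 / 2 + 1 - N%:R^-1 :> R.
Proof.
elim: N => // -[_ _|N /(_ isT) IH _].
  by rewrite big_nat1 ln1 mul0r invr1 expr2 mul0r mul0r add0r subrr.
rewrite big_nat_recr //=; apply: le_trans (lerD IH (lexx _)) _.
have h1 := @ln_succ_ge R N.+1 isT; have h2 := @ln_succ_le R N.+1 isT.
have l0 := @ln_nat_ge0 R N.+1.
move: h1 h2 l0; set b := ln N.+2%:R; set a := ln N.+1%:R.
have -> : N.+2%:R = N.+1%:R + 1 :> R by rewrite natr1.
have n0 : 1 <= N.+1%:R :> R by rewrite ler1n.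
set n := N.+1%:R in n0 *; move=> h1 h2 a0.
rewrite -subr_ge0.
have -> : b ^+ 2 / 2 + 1 - (n + 1)^-1 - (a ^+ 2 / 2 + 1 - n^-1 + b / (n + 1)) =
  ((n * (b - a)) * ((n + 1) * (b - a)) + 2 * a * n * ((n + 1) * (b - a))  + 2
   - 2 * b * n) / (2 * n * (n + 1)).
  by field; apply/andP; split; rewrite gt_eqF; lra.
rewrite divr_ge0 //; last by rewrite !mulr_ge0 //; lra.
have h3 : 0 <= n * (b - a) * ((n + 1) * (b - a)) by rewrite !mulr_ge0; nra.
have h4 : 2 * a * n * 1 <= 2 * a * n * ((n + 1) * (b - a)).
  by rewrite ler_wpM2l // !mulr_ge0 //; lra.
lra.
Qed.

(** Inserting [alpha] into every term of [selberg_log_square] merely returns [alpha], as twice the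
    sum of [ln k / k] is about [ln N ^ 2]. The windows save [a / 2] on a set of logarithmic mass
    [c * ln N ^ 2], hence [a * c] in total; half of it pays for the lower-order terms. This gain is
    the same for all [alpha >= a]. *)
Lemma psi_error_improve (R : realType) (a : R) : 0 < a -> a <= 1 ->
  exists c : R, 0 < c /\ forall alpha, a <= alpha ->
    (exists M, forall N, (M <= N)%N -> `|psi_error N| <= alpha * N%:R) ->
    exists M, forall N, (M <= N)%N -> `|psi_error N| <= (alpha - c) * N%:R.
Proof.
move=> a0 a1.
have [B [M1 [B1 hB]]] := psi_error_small_window a0 a1.
pose P (n : nat) := `|psi_error n : R| <= a / 2 * n%:R.
have ka0 : 0 < a / 16 by rewrite divr_gt0.
have ka1 : a / 16 <= 1 by lra.
have [c [c0 [N1 hN1]]] := @window_log_sum R P (a / 16) B M1 ka0 ka1 B1 hB.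
have [C [C0 hC]] := @selberg_log_square R.
have ac0 : 0 < a * c by rewrite mulr_gt0.
exists (a * c / 2); split; first by rewrite divr_gt0.
move=> alpha aalpha [M0 hM0].
set K := 2 * alpha + 20 * M0%:R + 2 * C.
have K0 : 0 <= K by rewrite /K; have : 0 <= M0%:R :> R by []; lra.
have [M2 hM2] := ln_nat_large (K / (a * c / 2) + 1).
exists (N1 + M2 + 1)%N => N hN.
have [N0 N1N M2N] : [/\ (0 < N)%N, (N1 <= N)%N & (M2 <= N)%N] by clear -hN; split; lia.
have n0 : 0 < N%:R :> R by rewrite ltr0n.
have hL : K / (a * c / 2) + 1 <= ln N%:R by exact: hM2.
have key := hC N N0; have def := hN1 N N1N.
set L := ln N%:R in key def hL.
have KL : K <= a * c / 2 * L.
  have : K / (a * c / 2) <= L by lra.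
  by rewrite ler_pdivrMr ?divr_gt0 // mulrC.
have L1 : 1 <= L.
  by have : 0 <= K / (a * c / 2) by [rewrite divr_ge0 // ltW // divr_gt0]; lra.
(* Inside [P] the coefficient [alpha] drops to [alpha - a / 2], which is at least [a / 2] as
   [a <= alpha]. Outside, [alpha] applies unless [N %/ k < M0], where the error is at most
   [10 * M0]; such terms add up to [O(N * ln N)]. *)
have bound k : (0 < k <= N)%N -> ln k%:R * `|psi_error (N %/ k)| <=
   N%:R * (alpha * (ln k%:R / k%:R)
     - a / 2 * (if P (N %/ k)%N then ln k%:R / k%:R else 0)
     + 10 * (M0%:R / N%:R * L)).
  move=> /andP[kp kN].
  have l0 := @ln_nat_ge0 R k; have rk0 : 0 < k%:R :> R by rewrite ltr0n.
  have lL : ln k%:R <= L by rewrite ler_ln_nat.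
  have dv := divn_le R N k.
  have M00 : 0 <= M0%:R :> R by [].
  have e1 : N%:R * (alpha * (ln k%:R / k%:R)
     - a / 2 * (if P (N %/ k)%N then ln k%:R / k%:R else 0)
     + 10 * (M0%:R / N%:R * L)) =
     ln k%:R * ((alpha - a / 2 * (P (N %/ k)%N)%:R) * (N%:R / k%:R)) + 10 * (M0%:R * L).
    by case: (P _); rewrite /= ?mulr1 ?mulr0; field; rewrite !gt_eqF.
  rewrite e1.
  have p1 : 0 <= 10 * (M0%:R * L) by rewrite !mulr_ge0 //; lra.
  case: (boolP (P (N %/ k)%N)) => /= hp.
    rewrite -[leLHS]addr0 lerD // ler_wpM2l // mulr1.
    apply: le_trans hp _; apply: (@le_trans _ _ (a / 2 * (N%:R / k%:R))).
      by rewrite ler_wpM2l // divr_ge0 // ltW.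
    rewrite ler_wpM2r ?divr_ge0 ?(ltW rk0) //; lra.
  rewrite mulr0 subr0; have [hk|hk] := leqP M0 (N %/ k)%N.
    rewrite -[leLHS]addr0 lerD // ler_wpM2l //.
    apply: le_trans (hM0 _ hk) _; rewrite ler_wpM2l //; lra.
  rewrite -[leLHS]add0r lerD //.
    by rewrite !mulr_ge0 ?divr_ge0 ?(ltW rk0) //; lra.
  apply: (@le_trans _ _ (L * (10 * M0%:R))); last by lra.
  apply: ler_pM => //; apply: le_trans (psi_error_le _ _) _.
  by rewrite ler_wpM2l // ler_nat ltnW.
have S := @sum_ln_div_le R N N0; rewrite -/L in S.
have i0 : 0 <= N%:R^-1 :> R by rewrite invr_ge0.
have {}S : \sum_(1 <= k < N.+1) ln k%:R / k%:R <= L ^+ 2 / 2 + 1 by move: S i0; set i := _^-1; lra.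
have tot : \sum_(1 <= k < N.+1) ln k%:R * `|psi_error (N %/ k)| <=
  N%:R * (alpha * (L ^+ 2 / 2 + 1) - a / 2 * (c * L ^+ 2) + 10 * (M0%:R * L)).
  apply: (@le_trans _ _ (\sum_(1 <= k < N.+1) N%:R * (alpha * (ln k%:R / k%:R)
     - a / 2 * (if P (N %/ k)%N then ln k%:R / k%:R else 0)
     + 10 * (M0%:R / N%:R * L)))).
    by rewrite !big_nat; apply: ler_sum.
  rewrite -mulr_sumr ler_wpM2l // !big_split /= sumrN -!mulr_sumr.
  apply: lerD; first apply: lerB.
  - by rewrite ler_wpM2l //; lra.
  - by rewrite ler_wpM2l //; lra.
  rewrite sumr_const_nat subn1 /= -[L *+ _]mulr_natl le_eqVlt; apply/orP; left; apply/eqP.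
  by field; rewrite gt_eqF.
have L2 : 0 < L ^+ 2 by rewrite exprn_gt0 //; lra.
rewrite -(ler_pM2r L2); apply: le_trans key _.
apply: le_trans (lerD (ler_wpM2l _ tot) (lexx _)) _ => //.
have -> : 2 * (N%:R * (alpha * (L ^+ 2 / 2 + 1) - a / 2 * (c * L ^+ 2) + 10 * (M0%:R * L)))
   + C * N%:R * (L + 1) =
   N%:R * (alpha * L ^+ 2 - a * c * L ^+ 2 + (2 * alpha + 20 * (M0%:R * L) + C * (L + 1))).
  by field.
have -> : (alpha - a * c / 2) * N%:R * L ^+ 2 =
  N%:R * (alpha * L ^+ 2 - a * c * L ^+ 2 + (a * c / 2 * L) * L) by field.
rewrite ler_pM2l // lerD2l.
apply: (@le_trans _ _ (K * L)); last by rewrite ler_wpM2r //; lra.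
have M00 : 0 <= M0%:R :> R by [].
have t1 : alpha * 1 <= alpha * L by rewrite ler_wpM2l //; lra.
have t2 : C * 1 <= C * L by rewrite ler_wpM2l //; lra.
rewrite /K; lra.
Qed.

(** If the infimum of the valid constants were positive, a valid one within [c] of it would be
    improved to one below it. *)
Lemma prime_number_theorem (R : realType) (eps : R) : 0 < eps ->
  exists M, forall N, (M <= N)%N -> `|psi_error N| <= eps * N%:R.
Proof.
move=> eps0.
pose A : set R := [set al | exists M, forall N, (M <= N)%N -> `|psi_error N| <= al * N%:R].
have Alb : lbound A 0.
  move=> al [M hM]; have := hM M.+1 (leqnSn M).
  move=> h; have := le_trans (normr_ge0 _) h.
  by rewrite pmulr_lge0 // ltr0n.
have Ainf : has_inf A.
  split; last by exists 0.
  by exists 10, 0%N => N _; exact: psi_error_le.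
have i0 : 0 <= inf A by apply: lb_le_inf; [exact: Ainf.1|].
have [iA|iA] := leP (inf A) 0.
  have [al [M hM] hal] := inf_adherent eps0 Ainf.
  exists M => N /hM h; apply: le_trans h _; rewrite ler_wpM2r //; lra.
set a := Num.min (inf A) 1.
have a0 : 0 < a by rewrite lt_min iA ltr01.
have a1 : a <= 1 by rewrite ge_min lexx orbT.
have [c [c0 hc]] := psi_error_improve a0 a1.
have [al Aal hal] := inf_adherent c0 Ainf.
have aal : a <= al.
  by rewrite ge_min ge_inf //; exact: Ainf.2.
have : A (al - c) by apply: hc.
move=> /(ge_inf Ainf.2); lra.
Qed.

(** The theorem makes [psi] strictly larger at [(1 + eps) * N] than at [N], so some [mangoldt k] in
    between is non-zero. *)
Lemma prime_power_between (R : realType) (eps : R) : 0 < eps ->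
  exists M, forall N, (M <= N)%N ->
    exists p k, [/\ prime p, (0 < k)%N, (N < p ^ k)%N &
      (p ^ k)%:R <= (1 + eps) * N%:R].
Proof.
wlog e1 : eps / eps <= 1.
  move=> H eps0; have [e1|e1] := leP eps 1; first exact: H.
  have [M hM] := H 1 (lexx _) ltr01; exists M => N /hM[p [k [pp k0 h1 h2]]].
  by exists p, k; split=> //; apply: le_trans h2 _; rewrite ler_wpM2r //; lra.
move=> eps0.
have e80 : 0 < eps / 8 by rewrite divr_gt0.
have [M hM] := prime_number_theorem e80.
have [M' hM'] := nat_above (4 / eps).
exists (M + M' + 1)%N => N hN.
have n0 : 0 < N%:R :> R by rewrite ltr0n; lia.
set N2 := Num.truncn ((1 + eps) * N%:R).
have /andP[t1 t2] := @truncn_itv R ((1 + eps) * N%:R) ltac:(rewrite mulr_ge0 //; lra).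
have eN : 4 <= eps * N%:R.
  move: hM'; rewrite ltr_pdivrMr // => h; have : M'%:R * eps <= N%:R * eps.
    by rewrite ler_pM2r // ler_nat; lia.
  lra.
have NN2 : (N <= N2)%N by rewrite -ltnS -(ltr_nat R); apply: le_lt_trans t2; lra.
have h1 := hM N ltac:(lia); have h2 := hM N2 ltac:(lia).
have psiN : psi N < psi N2 :> R.
  move: h1 h2; rewrite /psi_error !ler_norml => /andP[_ h1] /andP[h2 _].
  rewrite -[N2.+1%:R]natr1 -/N2 in t2; rewrite -/N2 in t1.
  have : eps / 8 * N2%:R <= eps / 8 * (2 * N%:R).
    rewrite ler_pM2l // (le_trans t1) //.
    by rewrite ler_pM2r //; lra.
  lra.
apply: contrapT => H; move: psiN; rewrite ltNge => /negP; apply.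
rewrite /psi (@big_cat_nat _ _ _ N.+1 1 N2.+1) //= [X in _ + X]big_nat [X in _ + X]big1 ?addr0 // => k /andP[Nk kN2].
apply/eqP; apply: contrapT => /negP /mangoldt_neq0[p [j [pp j0 kE]]].
apply: H; exists p, j; split=> //; first by rewrite -kE.
by rewrite -kE (le_trans _ t1) // ler_nat.
Qed.

(** * Dense Sidon sets *)

Lemma finField_primitive_root (F : finFieldType) :
  exists z : F, #|F|.-1.-primitive_root z.
Proof.
have F1 : (1 < #|F|)%N by exact: finNzRing_gt1.
have n0 : (0 < #|F|.-1)%N by lia.
have := @has_prim_root F #|F|.-1 (enum (predC1 (0 : F))) n0.
rewrite enum_uniq -cardE cardC1 leqnn => h.
suff all_root : all #|F|.-1.-unity_root (enum (predC1 (0 : F))).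
  by have /hasP[z _ hz] := h all_root isT isT; exists z.
apply/allP => x; rewrite mem_enum inE => x0; apply/unity_rootP.
apply: (mulfI x0); rewrite -exprS prednK ?expf_card ?mulr1 //; lia.
Qed.

(* Bose: the discrete logarithms of z + a, for a in the subfield of order q of
   the field of order q ^ 2, where z is a primitive element. *)
Lemma bose_sidon p k : prime p -> (0 < k)%N ->
  exists s : 'I_(p ^ k) -> nat, (forall i, (s i < (p ^ k) ^ 2)%N) /\
    forall i1 i2 j1 j2, (s i1 + s i2 = s j1 + s j2)%N ->
      (i1, i2) = (j1, j2) \/ (i1, i2) = (j2, j1).
Proof.
move=> pp k0; have k20 : (0 < k * 2)%N by rewrite muln_gt0 k0.
have [F pF cF] := PrimePowerField pp k20.
set q := (p ^ k)%N.
have q2 : (2 <= q)%N.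
  by rewrite (leq_trans (prime_gt1 pp)) // -{1}(expn1 p) leq_exp2l // prime_gt1.
have [z hz] := finField_primitive_root F.
rewrite cF expnM -/q in hz; set n := (q ^ 2).-1 in hz.
have nE : n = (q.+1 * q.-1)%N by rewrite /n -mulnn; nia.
have n0 : (0 < n)%N by exact: prim_order_gt0 hz.
have zn : z ^+ n = 1 by exact: prim_expr_order hz.
have z0 : z != 0.
  by apply/eqP => z0; move/eqP: zn; rewrite z0 expr0n gtn_eqF // eq_sym oner_eq0.
have qF : [pchar F].-nat q.
  by rewrite pnatX (eq_pnat _ (pcharf_eq pF)) pnat_id.
have frobD (x y : F) : (x + y) ^+ q = x ^+ q + y ^+ q by exact: exprDn_pchar.
have frobN (x : F) : (- x) ^+ q = - x ^+ q.
  apply/eqP; rewrite -subr_eq0 opprK -frobD addNr expr0n.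
  by case: q q2 {qF frobD nE n hz n0 zn} => //.
(* So [z] lies outside the subfield of order [q], the fixed points of the Frobenius map [x ^+ q]. *)
have zq : z ^+ q != z.
  apply/eqP => zq; have : z ^+ q.-1 = 1.
    by apply: (mulfI z0); rewrite -exprS prednK ?mulr1 //; lia.
  move/eqP; rewrite -(prim_order_dvd hz) => /dvdn_leq; nia.
(* An enumeration of that subfield: [z ^+ q.+1] has order [q.-1] and supplies the non-zero elements,
   and the last index stands for 0. *)
pose e (i : 'I_q) : F := if val i == q.-1 then 0 else z ^+ (q.+1 * i).
have e_frob i : e i ^+ q = e i.
  rewrite /e; case: ifP => _; first by rewrite expr0n; case: q q2 {qF frobD frobN nE n hz n0 zn zq e i}.
  have -> : (z ^+ (q.+1 * i)) ^+ q = z ^+ (q.+1 * i) * (z ^+ n) ^+ i.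
    by rewrite -!exprM -exprD nE; congr (_ ^+ _); case: q q2 {qF frobD frobN nE n hz n0 zn zq e} i => // q' _ i /=; nia.
  by rewrite zn expr1n mulr1.
have e_inj : injective e.
  move=> i j; rewrite /e; have iq := ltn_ord i; have jq := ltn_ord j.
  case: eqP => iE; case: eqP => jE.
  - by move=> _; apply: val_inj; rewrite iE.
  - by move/esym/eqP; rewrite expf_eq0 (negbTE z0) andbF.
  - by move/eqP; rewrite expf_eq0 (negbTE z0) andbF.
  move/eqP; rewrite (eq_prim_root_expr hz) !modn_small; first last.
  - by move: iE iq; rewrite nE /=; nia.
  - by move: jE jq; rewrite nE /=; nia.
  by rewrite eqn_pmul2l // => /eqP; exact: val_inj.
have ze i : z + e i != 0.
  apply: contra zq; rewrite addr_eq0 => /eqP ->.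
  by rewrite frobN e_frob.
have unit_root (x : F) : x != 0 -> x ^+ n = 1.
  move=> x0; apply: (mulfI x0); rewrite -exprS mulr1.
  have -> : n.+1 = #|F| by rewrite cF expnM /n prednK // expn_gt0 (ltnW q2).
  exact: expf_card.
pose s i := val (sval (prim_rootP hz (unit_root _ (ze i)))).
have sE i : z ^+ s i = z + e i.
  by rewrite /s; case: (prim_rootP hz _).
exists s; split=> [i|i1 i2 j1 j2 E].
  by apply: (@leq_trans n); [exact: ltn_ord | rewrite /n leq_pred].
have : (z + e i1) * (z + e i2) = (z + e j1) * (z + e j2).
  by rewrite -!sE -!exprD E.
move: (e_frob i1) (e_frob i2) (e_frob j1) (e_frob j2).
move=> h1 h2 h3 h4 h5.
(* The two products are monic quadratics in [z], so their difference is linear with coefficients in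
   the subfield. A non-zero leading coefficient would put [z] itself in the subfield. *)
have lin : (e i1 + e i2 - e j1 - e j2) * z = e j1 * e j2 - e i1 * e i2.
  by apply/eqP; rewrite -subr_eq0; apply/eqP; rewrite -[RHS](subrr ((z + e i1) * (z + e i2))) [X in _ = _ - X]h5; ring.
have sum0 : e i1 + e i2 - e j1 - e j2 = 0.
  apply/eqP; apply: contraNT zq => d0; apply/eqP; apply: (mulfI d0).
  rewrite lin.
  have -> : e i1 + e i2 - e j1 - e j2 = (e i1 + e i2 - e j1 - e j2) ^+ q.
    by rewrite !frobD !frobN h1 h2 h3 h4.
  by rewrite -exprMn lin frobD frobN !exprMn h1 h2 h3 h4.
move: lin; rewrite sum0 mul0r => /esym/eqP; rewrite subr_eq0 => /eqP prd.
(* Equal sums and equal products: [e i1] is a root of the polynomial with roots [e j1] and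
   [e j2]. *)
have : (e i1 - e j1) * (e i1 - e j2) = 0.
  have -> : (e i1 - e j1) * (e i1 - e j2) =
     e i1 * (e i1 + e i2 - e j1 - e j2) + (e j1 * e j2 - e i1 * e i2) by ring.
  by rewrite sum0 prd subrr mulr0 addr0.
move/eqP; rewrite mulf_eq0 !subr_eq0 => /orP[] /eqP h.
  left; have -> : i1 = j1 by exact: e_inj.
  congr (_, _); apply: e_inj; apply/eqP; rewrite -subr_eq0; apply/eqP.
  by rewrite -sum0 h; ring.
right; have -> : i1 = j2 by exact: e_inj.
congr (_, _); apply: e_inj; apply/eqP; rewrite -subr_eq0; apply/eqP.
by rewrite -sum0 h; ring.
Qed.

(** * Channel configurations *)

Definition separated {R : realType} (W : R) {N : nat} (c : 'I_N -> R) : Prop :=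
  forall n1 n2 n n3 : 'I_N, (n1, n2) <> (n, n3) -> (n1, n2) <> (n3, n) ->
    2 * W < `|c n1 + c n2 - c n - c n3|.

Lemma admissibleP (R : realType) (W : R) N (c : 'I_N -> R) : 0 < W ->
  admissible W c <-> separated W c.
Proof.
move=> W0; split=> [[_ h] n1 n2 n n3 ne1 ne2|h].
  rewrite ltNge; apply/negP => le2W.
  have /seteqP[+ _] := h _ _ _ _ ne1 ne2.
  set d := c n1 + c n2 - c n - c n3 in le2W.
  (* A common point of the two sums is obtained by moving each of the four centres by a quarter of
     the discrepancy [d]. *)
  have d4 : `|d / 4| <= W / 2.
    by rewrite normrM (ger0_norm (_ : 0 <= 4^-1)) ?invr_ge0 //; lra.
  move=> /(_ (c n1 - d / 4 + (c n2 - d / 4))); apply; split.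
    exists (c n1 - d / 4), (c n2 - d / 4); split=> //; rewrite /chan /=.
      by have -> : c n1 - d / 4 - c n1 = - (d / 4); [ring | rewrite normrN].
    by have -> : c n2 - d / 4 - c n2 = - (d / 4); [ring | rewrite normrN].
  exists (c n + d / 4), (c n3 + d / 4); split; rewrite /chan /=.
  - by have -> : c n + d / 4 - c n = d / 4 by ring.
  - by have -> : c n3 + d / 4 - c n3 = d / 4 by ring.
  - by rewrite /d; field.
split=> [n m nm|n1 n2 n n3 ne1 ne2].
  apply/seteqP; split=> // w [] /=; rewrite /chan /= !ler_norml => /andP[a1 a2] /andP[b1 b2].
  (* Comparing [(n, n)] with [(n, m)] bounds the distance of the two centres themselves from below
     by [2 * W]. *)
  have h1 : (n, n) <> (n, m) by case.
  have h2 : (n, n) <> (m, n) by case.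
  have := h _ _ _ _ h1 h2; rewrite ltNge => /negP; apply.
  by rewrite ler_norml; apply/andP; split; lra.
apply/seteqP; split=> // w [] /= [a1 [b1 [ha1 hb1 ->]]] [a2 [b2 [ha2 hb2 E]]].
have := h _ _ _ _ ne1 ne2; rewrite ltNge => /negP; apply.
move: ha1 hb1 ha2 hb2; rewrite /chan /= !ler_norml.
move=> /andP[? ?] /andP[? ?] /andP[? ?] /andP[? ?].
by apply/andP; split; lra.
Qed.

(** * Sorted centres and the lower bound for their span *)

Lemma sort_perm_exists (R : realType) N (c : 'I_N -> R) :
  exists s : {perm 'I_N}, forall i j : 'I_N, (i <= j)%N -> c (s i) <= c (s j).
Proof.
pose t := [tuple c i | i < N].
have /tuple_permP[s hs] : perm_eq (sort <=%R t) t by rewrite perm_sort.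
exists s => i j ij.
have st : sorted <=%R (sort <=%R t) by apply: sort_sorted; exact: le_total.
have nthE (k : 'I_N) : nth 0 (sort <=%R t) k = c (s k).
  by rewrite hs -tnth_nth !tnth_mktuple.
rewrite -!nthE; apply: sorted_leq_nth => //.
- exact: le_trans.
- by rewrite inE size_sort size_tuple.
- by rewrite inE size_sort size_tuple.
Qed.

Lemma sumn_uniq_pos (s : seq nat) : uniq s -> all (leq 1) s ->
  (size s * (size s).+1 <= 2 * sumn s)%N.
Proof.
have path_sum a t : path ltn a t -> (size t * (2 * a + size t + 1) <= 2 * sumn t)%N.
  elim: t a => [|b t IH] a //= /andP[ab /IH]; nia.
move=> us ps; have pst : perm_eq (sort leq s) s by rewrite perm_sort.
rewrite -(perm_size pst) -(perm_sumn pst).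
have srt : sorted ltn (sort leq s).
  by rewrite ltn_sorted_uniq_leq sort_uniq us (sort_sorted leq_total).
have : path ltn 0 (sort leq s).
  rewrite path_sortedE; last exact: ltn_trans.
  by rewrite srt andbT all_sort.
by move/path_sum; rewrite muln0 add0n addn1.
Qed.

Lemma lindstrom_bound (R : realType) (y : nat -> R) (d : R) N m : 0 < d -> (m < N)%N ->
  (forall i j, (i <= j < N)%N -> y i <= y j) ->
  (forall i j, (i < j < N)%N -> d <= y j - y i) ->
  (forall i r j s, (0 < r)%N -> (0 < s)%N -> (i + r < N)%N -> (j + s < N)%N ->
     (i, r) <> (j, s) -> d <= `|y (i + r)%N - y i - (y (j + s)%N - y j)|) ->
  d * (m%:R * (2 * N%:R - m%:R - 1)) ^+ 2 <= 4 * (m%:R * (m%:R + 1) * (y N.-1 - y 0%N)).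
Proof.
move=> d0 mN mono sep1 sep2.
have iotaS_rcons j : iota 1 j.+1 = iota 1 j ++ [:: j.+1].
  by rewrite -(addn1 j) iotaD add1n addn1.
pose ps := [seq (i, r) | r <- iota 1 m, i <- iota 0 (N - r)].
have psP (x : nat * nat) : x \in ps -> (0 < x.2)%N /\ (x.1 + x.2 < N)%N.
  move=> /allpairsPdep[r [i [hr hi ->]]] /=.
  by move: hr hi; rewrite !mem_iota; lia.
pose g (x : nat * nat) : R := y (x.1 + x.2)%N - y x.1.
(* Differences that are at least [d] and pairwise at least [d] apart have distinct positive integer
   parts after division by [d]; this reduces the bound to a sum of distinct positive integers. *)
pose f (x : nat * nat) : nat := Num.truncn (g x / d).
have g_ge (x : nat * nat) : x \in ps -> d <= g x.
  case: x => i r /psP /= [r0 irN]; apply: sep1.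
  by apply/andP; split=> //; rewrite -[X in (X < _)%N]addn0 ltn_add2l.
have gd0 x : x \in ps -> 0 <= g x / d.
  by move=> /g_ge h; rewrite divr_ge0 ?(ltW d0) // (le_trans (ltW d0)).
have uf : uniq [seq f x | x <- ps].
  rewrite map_inj_in_uniq.
    apply: allpairs_uniq_dep; rewrite ?iota_uniq //.
      by move=> r _; rewrite iota_uniq.
    by move=> [r1 i1] [r2 i2] /= _ _ [-> ->].
  move=> [i r] [j s] hx hy fE; apply/eqP; apply: contraT => /eqP ne.
  have [h1 h2] := psP _ hx; have [h3 h4] := psP _ hy.
  have := sep2 i r j s h1 h3 h2 h4 ne; rewrite -[X in `|X|]/(g (i, r) - g (j, s)).
  have /andP[] := truncn_itv (gd0 _ hx); have /andP[] := truncn_itv (gd0 _ hy).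
  rewrite -/(f (i, r)) -/(f (j, s)) -fE -[(f (i, r)).+1%:R]natr1.
  rewrite !ler_pdivlMr // !ltr_pdivrMr // => b1 b2 b3 b4.
  by rewrite leNgt ltr_norml => /negP[]; apply/andP; split; lra.
have pf : all (leq 1) [seq f x | x <- ps].
  rewrite all_map; apply/allP => x hx /=.
  have := g_ge x hx; have /andP[_] := truncn_itv (gd0 _ hx).
  rewrite -/(f x); case: (f x) => // h1 h2.
  by move: h1; rewrite ltNge ler_pdivlMr // mul1r h2.
have := sumn_uniq_pos uf pf; rewrite size_map => szf.
have szE : 2 * (size ps)%:R = m%:R * (2 * N%:R - m%:R - 1) :> R.
  rewrite /ps size_allpairs_dep; move: mN {ps psP g_ge gd0 uf pf szf}.
  elim: m => [|m IH] mN; first by rewrite !mul0r mulr0.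
  rewrite iotaS_rcons map_cat sumn_cat natrD mulrDr IH; last by lia.
  rewrite /= size_iota addn0 natrB; last by lia.
  by rewrite -[m.+1%:R]natr1; ring.
have sum_low : d * (sumn [seq f x | x <- ps])%:R <= \sum_(x <- ps) g x.
  rewrite sumnE big_map natr_sum mulr_sumr big_seq [leRHS]big_seq.
  apply: ler_sum => x hx; rewrite mulrC -ler_pdivlMr //.
  by have /andP[] := truncn_itv (gd0 _ hx).
(* For a fixed lag [r] the sum telescopes to the last [r] values minus the first [r] values. *)
have sum_up : \sum_(x <- ps) g x <= \sum_(r <- iota 1 m) r%:R * (y N.-1 - y 0%N).
  rewrite /ps big_allpairs_dep big_seq [leRHS]big_seq; apply: ler_sum => r.
  rewrite mem_iota => hr; have rN : (r <= N)%N by lia.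
  rewrite /g /= sumrB.
  have e1 : \sum_(i <- iota 0 (N - r)) y (i + r)%N = \sum_(r <= i < N) y i.
    have := big_addn 0 N r xpredT y; rewrite add0n => ->.
    by rewrite /index_iota subn0.
  have e2 : \sum_(i <- iota 0 (N - r)) y i = \sum_(0 <= i < N - r) y i.
    by rewrite /index_iota subn0.
  have e3 : \sum_(0 <= i < N) y i = \sum_(0 <= i < r) y i + \sum_(r <= i < N) y i.
    by rewrite -big_cat_nat.
  have e4 : \sum_(0 <= i < N) y i = \sum_(0 <= i < N - r) y i + \sum_(N - r <= i < N) y i.
    by rewrite -big_cat_nat ?leq_subr.
  have b1 : r%:R * y 0%N <= \sum_(0 <= i < r) y i.
    have -> : r%:R * y 0%N = \sum_(0 <= i < r) y 0%N by rewrite sumr_const_nat subn0 mulr_natl.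
    by rewrite !big_nat; apply: ler_sum => i hi; apply: mono; lia.
  have b2 : \sum_(N - r <= i < N) y i <= r%:R * y N.-1.
    have -> : r%:R * y N.-1 = \sum_(N - r <= i < N) y N.-1.
      by rewrite sumr_const_nat subKn // mulr_natl.
    by rewrite !big_nat; apply: ler_sum => i hi; apply: mono; lia.
  by rewrite e1 e2; lra.
have tri : 2 * \sum_(r <- iota 1 m) r%:R * (y N.-1 - y 0%N) = m%:R * (m%:R + 1) * (y N.-1 - y 0%N).
  rewrite -mulr_suml mulrA; congr (_ * _).
  elim: m {mN ps psP g_ge gd0 uf pf szf szE sum_low sum_up} => [|m IH].
    by rewrite big_nil mulr0 mul0r.
  by rewrite iotaS_rcons big_cat /= mulrDr IH big_seq1 -[m.+1%:R]natr1; ring.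
have szf' : (size ps)%:R ^+ 2 <= 2 * (sumn [seq f x | x <- ps])%:R :> R.
  by rewrite -natrX -natrM ler_nat (leq_trans _ szf) // -mulnn leq_mul.
rewrite -szE.
have := ler_wpM2l (ltW d0) szf'; rewrite exprMn; lra.
Qed.

Lemma separated_span (R : realType) (W : R) N (c : 'I_N.+1 -> R) m :
  0 < W -> (m < N.+1)%N -> separated W c ->
  exists i j, W * (m%:R * (2 * N.+1%:R - m%:R - 1)) ^+ 2 <=
     2 * (m%:R * (m%:R + 1) * (c i - c j)).
Proof.
move=> W0 mN sep; have [s hs] := sort_perm_exists c.
pose y k := c (s (inord k)).
have sep' i j k l : (i < N.+1)%N -> (j < N.+1)%N -> (k < N.+1)%N -> (l < N.+1)%N ->
    (i, j) <> (k, l) -> (i, j) <> (l, k) -> 2 * W < `|y i + y j - y k - y l|.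
  move=> hi hj hk hl n1 n2; apply: sep.
    case=> /perm_inj/(congr1 val) e1 /perm_inj/(congr1 val) e2; apply: n1.
    by move: e1 e2; rewrite /= !inordK // => -> ->.
  case=> /perm_inj/(congr1 val) e1 /perm_inj/(congr1 val) e2; apply: n2.
  by move: e1 e2; rewrite /= !inordK // => -> ->.
have mono i j : (i <= j < N.+1)%N -> y i <= y j.
  by move=> /andP[ij jN]; apply: hs; rewrite !inordK //; lia.
have W20 : 0 < 2 * W by lra.
have := @lindstrom_bound R y (2 * W) N.+1 m W20 mN mono.
move=> H; exists (s (inord N)), (s (inord 0)); rewrite -/(y N) -/(y 0%N).
have {H} := H _ _.
have b1 i j : (i < j < N.+1)%N -> 2 * W <= y j - y i.
  move=> ij; have : 2 * W < `|y j + y j - y i - y j|.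
    by apply: sep'; [lia..|case; lia|case; lia].
  have -> : y j + y j - y i - y j = y j - y i by ring.
  by rewrite ger0_norm ?subr_ge0 ?mono //; [lra|lia].
have b2 i r j q : (0 < r)%N -> (0 < q)%N -> (i + r < N.+1)%N -> (j + q < N.+1)%N ->
     (i, r) <> (j, q) -> 2 * W <= `|y (i + r)%N - y i - (y (j + q)%N - y j)|.
  move=> r0 q0 hi hj ne.
  (* The index pairs [(i + r, j)] and [(j + q, i)] agree in this order only if [i = j] and [r = q],
     and in the opposite order only for lag 0. *)
  have -> : y (i + r)%N - y i - (y (j + q)%N - y j) = y (i + r)%N + y j - y (j + q)%N - y i by ring.
  apply/ltW/sep'; try lia.
    by case=> e1 e2; apply: ne; rewrite e2 in e1 *; congr (_, _); lia.
  by case; lia.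
move=> /(_ b1 b2) /=; lra.
Qed.

(** * Bandwidth and efficiency *)

Lemma band_span_ge (R : realType) (W : R) N (c : 'I_N -> R) i j : 0 < W ->
  c i - c j + W <= sup (band W c) - inf (band W c).
Proof.
move=> W0.
pose M := \sum_(k < N) `|c k|.
have cM k : `|c k| <= M.
  by rewrite /M (bigD1 k) //= lerDl sumr_ge0.
have bnd w : band W c w -> - (M + W) <= w <= M + W.
  move=> [k _]; rewrite /chan /= ler_norml => /andP[h1 h2].
  by have := cM k; rewrite ler_norml => /andP[h3 h4]; apply/andP; split; lra.
have b1 : band W c (c i + W / 2).
  by exists i => //; rewrite /chan /= addrAC subrr add0r ger0_norm // divr_ge0 // ltW.
have b2 : band W c (c j - W / 2).
  by exists j => //; rewrite /chan /= addrAC subrr add0r normrN ger0_norm // divr_ge0 // ltW.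
have u1 : c i + W / 2 <= sup (band W c).
  by apply: ub_le_sup => //; exists (M + W) => w /bnd/andP[].
have u2 : inf (band W c) <= c j - W / 2.
  by apply: ge_inf => //; exists (- (M + W)) => w /bnd/andP[].
lra.
Qed.

Lemma band_span_le (R : realType) (W : R) N (c : 'I_N -> R) a b : 0 < W -> (0 < N)%N ->
  (forall i, a <= c i <= b) -> sup (band W c) - inf (band W c) <= b - a + W.
Proof.
move=> W0 N0 hab.
have ne : band W c !=set0.
  exists (c (Ordinal N0)), (Ordinal N0) => //.
  by rewrite /chan /= subrr normr0 divr_ge0 // ltW.
have bnd w : band W c w -> a - W / 2 <= w <= b + W / 2.
  move=> [k _]; rewrite /chan /= ler_norml => /andP[h1 h2].
  by have /andP[h3 h4] := hab k; apply/andP; split; lra.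
have u1 : sup (band W c) <= b + W / 2 by apply: ge_sup => // w /bnd/andP[].
have u2 : a - W / 2 <= inf (band W c) by apply: lb_le_inf => // w /bnd/andP[].
lra.
Qed.

(** Once [N] is large compared with [m / eps], the span is at least [2 * W * N ^ 2] times
    [m / (m + 1)] and [1 - eps / 4]. Taking [m > 1 / eps] keeps both losses within [eps]. *)
Lemma efficiency_upper (R : realType) (W eps : R) : 0 < W -> 0 < eps -> eps <= 1 ->
  exists M, forall N, (M <= N)%N -> forall c : 'I_N -> R, admissible W c ->
    efficiency W c * N%:R <= 2^-1 + eps.
Proof.
move=> W0 e0 e1; have [m hm] := nat_above (1 / eps).
have [M hM] := nat_above (4 * m.+1%:R / eps).
exists (M + m.+2)%N => -[|N] hN c /(admissibleP _ W0) sep; first by lia.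
have [|i [j hij]] := @separated_span R W N c m W0 _ sep; first by lia.
have := band_span_ge c i j W0; rewrite /efficiency.
set S := sup _ - inf _ => hS.
rewrite sumr_const card_ord -[W *+ _]mulr_natl.
set n := N.+1%:R in hij *.
have em : 1 < m%:R * eps by move: hm; rewrite ltr_pdivrMr.
have m0 : 0 < m%:R :> R by rewrite ltr0n; case: m {hM hN hij} hm em => //; rewrite mul0r; lra.
have m1 : m.+1%:R = m%:R + 1 :> R by rewrite natr1.
have nm : 4 * (m%:R + 1) <= eps * n.
  have : 4 * m.+1%:R / eps <= n by rewrite ltW // (lt_le_trans hM) // /n ler_nat; lia.
  by rewrite ler_pdivrMr // m1; lra.
have n0 : 0 < n by rewrite /n ltr0n.
have key : W * m%:R * (2 * n - m%:R - 1) ^+ 2 <= 2 * ((m%:R + 1) * (c i - c j)).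
  rewrite -(ler_pM2l m0); move: hij; rewrite exprMn; set sq := (2 * n - _ - _) ^+ 2.
  rewrite expr2; lra.
have sq : 4 * n ^+ 2 * (1 - eps / 4) <= (2 * n - m%:R - 1) ^+ 2.
  have : n * (4 * (m%:R + 1)) <= n * (eps * n) by rewrite ler_pM2l.
  have : 0 <= (m%:R + 1 : R) ^+ 2 by rewrite exprn_even_ge0.
  rewrite !expr2; lra.
have Wm : 0 < W * m%:R by rewrite mulr_gt0.
have low : W * m%:R * (4 * n ^+ 2 * (1 - eps / 4)) <= 2 * ((m%:R + 1) * (c i - c j)).
  by apply: le_trans key; rewrite ler_pM2l.
have n20 : 0 < n ^+ 2 by rewrite exprn_gt0.
have S0 : 0 < S.
  apply: lt_le_trans hS; apply: addr_gt0 => //.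
  have : 0 < W * m%:R * (4 * n ^+ 2 * (1 - eps / 4)) by rewrite !mulr_gt0 //; lra.
  move=> h; have := lt_le_trans h low; rewrite pmulr_rgt0 // pmulr_rgt0 //; lra.
rewrite mulrAC ler_pdivrMr //.
apply: (@le_trans _ _ ((2^-1 + eps) * (c i - c j))); last first.
  by rewrite ler_wpM2l //; lra.
have mp : 0 < 2 * (m%:R + 1) :> R by lra.
rewrite -(ler_pM2l mp).
have -> : 2 * (m%:R + 1) * ((2^-1 + eps) * (c i - c j)) =
   (2^-1 + eps) * (2 * ((m%:R + 1) * (c i - c j))) by ring.
apply: (@le_trans _ _ ((2^-1 + eps) * (W * m%:R * (4 * n ^+ 2 * (1 - eps / 4))))); last first.
  by rewrite ler_pM2l //; lra.
have -> : 2 * (m%:R + 1) * (n * W * n) = W * n ^+ 2 * (2 * (m%:R + 1)) by ring.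
have -> : (2^-1 + eps) * (W * m%:R * (4 * n ^+ 2 * (1 - eps / 4))) =
  W * n ^+ 2 * (m%:R * ((2 + 4 * eps) * (1 - eps / 4))) by field.
rewrite ler_pM2l ?mulr_gt0 //.
have : m%:R * (2 + 2 * eps) <= m%:R * ((2 + 4 * eps) * (1 - eps / 4)).
  by rewrite ler_pM2l //; nra.
lra.
Qed.

(** The centres are [N] of the [q] elements of a Bose set, with [q <= (1 + h) * N]. Two factors
    [1 + h] in the span come from [q ^ 2] and one from the scaling; [h = eps / 8] suffices for all
    three and for the extra width [W]. *)
Lemma efficiency_lower (R : realType) (W eps : R) : 0 < W -> 0 < eps -> eps <= 1 ->
  exists M, forall N, (M <= N)%N -> exists c : 'I_N -> R, admissible W c /\
    2^-1 - eps <= efficiency W c * N%:R.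
Proof.
move=> W0 e0 e1; set h := eps / 8.
have h0 : 0 < h by rewrite divr_gt0.
have [M hM] := prime_power_between h0.
have [M' hM'] := nat_above (1 / h).
exists (M + M' + 1)%N => N hN.
have N0 : (0 < N)%N by lia.
have [p [k [pp k0 Nq qN]]] := hM N ltac:(lia).
have [s [sq sS]] := bose_sidon pp k0.
move: s sq sS Nq qN; set q := (p ^ k)%N => s sq sS Nq qN.
(* Distinct integer sums may differ by exactly 1, while the separation must exceed [2 * W] strictly;
   hence the factor [1 + h]. *)
pose c (i : 'I_N) : R := 2 * W * (1 + h) * (s (widen_ord (ltnW Nq) i))%:R.
have W2 : 0 < 2 * W * (1 + h) by rewrite !mulr_gt0 //; lra.
exists c; split.
  apply/admissibleP => // n1 n2 n n3 ne1 ne2.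
  rewrite /c -mulrDr -!mulrBr normrM (gtr0_norm W2).
  set w := widen_ord _.
  apply: (@lt_le_trans _ _ (2 * W * (1 + h))); first by rewrite ltr_pMr; lra.
  rewrite ler_peMr ?(ltW W2) // -addrA -opprD -!natrD.
  have : (s (w n1) + s (w n2))%N != (s (w n) + s (w n3))%N.
    have winj : injective w by move=> i j /(congr1 val) /= e; apply: val_inj.
    apply/eqP => /sS[E|E]; [apply: ne1|apply: ne2]; congr (_, _); apply: winj;
      by [exact: (congr1 fst E)|exact: (congr1 snd E)].
  set a := (_ + _)%N; set b := (_ + _)%N => ab.
  have [lt|lt|eqab] := ltgtP a b; last by rewrite eqab eqxx in ab.
    by rewrite distrC -natrB ?(ltnW lt) // normr_nat ler1n subn_gt0.
  by rewrite -natrB ?(ltnW lt) // normr_nat ler1n subn_gt0.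
have n0 : 0 < N%:R :> R by rewrite ltr0n.
have span := @band_span_le R W N c 0 (2 * W * (1 + h) * q%:R ^+ 2) W0 N0.
have {}span : sup (band W c) - inf (band W c) <= 2 * W * (1 + h) * q%:R ^+ 2 - 0 + W.
  apply: span => i; rewrite /c mulr_ge0 ?(ltW W2) //= ler_pM2l //.
  by rewrite -natrX ler_nat ltnW.
have span0 := band_span_ge c (Ordinal N0) (Ordinal N0) W0.
move: span span0; rewrite /efficiency; set S := sup _ - inf _ => span span0.
have S0 : 0 < S by lra.
rewrite sumr_const card_ord -[W *+ _]mulr_natl mulrAC ler_pdivlMr //.
have q2 : q%:R ^+ 2 <= ((1 + h) * N%:R) ^+ 2.
  by rewrite ler_sqr ?nnegrE //; rewrite mulr_ge0 //; lra.
have hn : 1 <= h * N%:R.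
  move: hM'; rewrite ltr_pdivrMr // => hM'; apply/ltW/(lt_le_trans hM').
  by rewrite mulrC ler_pM2l // ler_nat; clear -hN; lia.
have n1 : 1 <= N%:R :> R by rewrite ler1n.
have {}span : S <= W * N%:R ^+ 2 * (2 * (1 + h) ^+ 3 + h).
  have a1 : 2 * W * (1 + h) * q%:R ^+ 2 <= 2 * W * (1 + h) * ((1 + h) * N%:R) ^+ 2 by rewrite ler_pM2l.
  have a2 : W * 1 <= W * (N%:R * (h * N%:R)).
    by rewrite ler_pM2l // -[leLHS]mulr1 ler_pM.
  apply: le_trans span _.
  have -> : W * N%:R ^+ 2 * (2 * (1 + h) ^+ 3 + h) =
    2 * W * (1 + h) * ((1 + h) * N%:R) ^+ 2 + W * (N%:R * (h * N%:R)) by ring.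
  by lra.
have [neg|pos] := leP (2^-1 - eps) 0.
  by apply: (@le_trans _ _ 0); [rewrite mulr_le0_ge0 // ltW | rewrite !mulr_ge0 // ltW].
apply: (le_trans (ler_wpM2l (ltW pos) span)).
have -> : N%:R * W * N%:R = W * N%:R ^+ 2 * 1 by ring.
rewrite mulrCA ler_pM2l ?mulr_gt0 ?exprn_gt0 //.
have h18 : h <= 8^-1 by rewrite /h; lra.
have cube : 2 * (1 + h) ^+ 3 + h <= 2 + 16 * h.
  rewrite -[3%N]/(2 + 1)%N exprD expr1 expr2; nra.
apply: (le_trans (ler_wpM2l (ltW pos) cube)).
rewrite /h; nra.
Qed.

Theorem theorem4 (R : realType) (W : R) (hW : 0 < W) :
  (exists C : R, forall N : nat, (0 < N)%N -> `|eta_opt W N| <= C / N%:R) /\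
  ((fun N : nat => eta_opt W N * N%:R) @ \oo --> (2^-1 : R)).
Proof.
have lim : (fun N : nat => eta_opt W N * N%:R) @ \oo --> (2^-1 : R).
  apply/cvgrPdist_le => /= e' e'0.
  pose e := Num.min e' 1.
  have e0 : 0 < e by rewrite lt_min e'0 ltr01.
  have e1 : e <= 1 by rewrite ge_min lexx orbT.
  have ee : e <= e' by rewrite ge_min lexx.
  have [M1 hM1] := efficiency_upper hW e0 e1.
  have [M2 hM2] := efficiency_lower hW e0 e1.
  exists (M1 + M2 + 1)%N => // N /= hN.
  have n0 : 0 < N%:R :> R by rewrite ltr0n; lia.
  have [c [adm low]] := hM2 N ltac:(lia).
  have up x : [set x | exists c : 'I_N -> R, admissible W c /\ x = efficiency W c] x ->
      x <= (2^-1 + e) / N%:R.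
    by move=> [c' [adm' ->]]; rewrite ler_pdivlMr // hM1 //; lia.
  (* For such [N] the set of efficiencies is non-empty and bounded above, so its [sup] is a genuine
     supremum and not a default value. *)
  have s1 : eta_opt W N <= (2^-1 + e) / N%:R.
    by apply: ge_sup; [exists (efficiency W c), c | move=> x; exact: up].
  have s2 : efficiency W c <= eta_opt W N.
    by apply: ub_le_sup; [exists ((2^-1 + e) / N%:R) => x; exact: up | exists c].
  rewrite ler_pdivlMr // in s1.
  have s3 : efficiency W c * N%:R <= eta_opt W N * N%:R by rewrite ler_pM2r.
  apply: le_trans ee; rewrite ler_norml; apply/andP; split; lra.
split=> //.
(* A convergent sequence is bounded at all indices, which also covers the small [N] that the
   asymptotic bounds do not reach. *)
have cv : cvgn (fun N : nat => eta_opt W N * N%:R) by apply/cvg_ex; exists 2^-1.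
have [C [Creal hC]] := cvg_seq_bounded cv.
exists (C + 1) => N N0; have n0 : 0 < N%:R :> R by rewrite ltr0n.
rewrite ler_pdivlMr // -[X in _ * X](gtr0_norm n0) -normrM.
by apply: (hC (C + 1)) => //; rewrite ltrDl.
Qed.
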